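(* Let $p$ be a prime and let $\mathbf{c}=(c_n)_{n\ge1}$ be an oscillating sequence of complex numbers satisfying the growth condition $\sum_{n=1}^N|c_n|^\lambda=O(N)$ for some $\lambda>1$. Then $\mathbf{c}$ is linearly disjoint from every $p$-adic rational flow $\mathcal{X}=(\mathbb{P}^1(\mathbb{Q}_p),R)$, where $R\in\mathbb{Q}_p(x)$ is a rational map with good reduction.
   Context: $\mathbb{P}^1(\mathbb{Q}_p)$ is the projective line over $\mathbb{Q}_p$ with the spherical metric: for $u=[x_1:y_1]$, $v=[x_2:y_2]$, $$\rho(u,v)=\frac{|x_1y_2-x_2y_1|_p}{\max\{|x_1|_p,|y_1|_p\}\max\{|x_2|_p,|y_2|_p\}}.$$ A rational map $R\in\mathbb{Q}_p(x)$ induces a continuous map of $\mathbb{P}^1(\mathbb{Q}_p)$. Good reduction has its standard meaning: writing $R=[F:G]$ with $F,G$ homogeneous polynomials of the same degree $\deg R$ in two variables with coefficients in $\mathbb{Z}_p$, at least one coefficient being a unit, the reductions of $F,G$ modulo $p$ have no common zero in $\mathbb{P}^1(\overline{\mathbb{F}}_p)$ (equivalently, the resultant of $F$ and $G$ is a $p$-adic unit). A sequence $(c_n)_{n\ge1}$ of complex numbers is oscillating if $\lim_{N\to\infty}\frac1N\sum_{n=1}^N c_n e^{-2\pi i n t}=0$ for every $t\in[0,1)$. For a compact metric space $X$ and a continuous map $T:X\to X$, $(c_n)$ is linearly disjoint from the flow $(X,T)$ if $\lim_{N\to\infty}\frac1N\sum_{n=1}^N c_n f(T^n x)=0$ for every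 continuous $f:X\to\mathbb{C}$ and every $x\in X$. *)

(* Defs.v *)
From HB Require Import structures.
From mathcomp Require Import all_boot all_order all_algebra.
From mathcomp Require Import generic_quotient ring_quotient fraction closed_field.
From mathcomp Require Import complex ring.
From mathcomp Require Import all_classical all_reals all_analysis.

Set Implicit Arguments.
Unset Strict Implicit.
Unset Printing Implicit Defensive.

Import Order.TTheory GRing.Theory Num.Theory numFieldNormedType.Exports.

Local Open Scope classical_set_scope.
Local Open Scope ring_scope.
Local Open Scope quotient_scope.

Section RatPadicNorm.
Variables (p : nat) (pr_p : prime p).
Implicit Types (x y : rat) (a b d : int).

Definition rat_padic_norm x : rat :=
  if x == 0 then 0
  else p%:R ^ ((logn p `|denq x|)%:Z - (logn p `|numq x|)%:Z).

Let pQ_gt0 : 0 < p%:R :> rat. Proof. by rewrite ltr0n prime_gt0. Qed.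
Let pQ_neq0 : p%:R != 0 :> rat. Proof. exact: lt0r_neq0. Qed.
Let pQ_gt1 : 1 < p%:R :> rat. Proof. by rewrite ltr1n prime_gt1. Qed.

Lemma rat_padic_norm0 : rat_padic_norm 0 = 0.
Proof. by rewrite /rat_padic_norm eqxx. Qed.

Lemma rat_padic_norm_frac a b : a != 0 -> b != 0 ->
  rat_padic_norm (a%:Q / b%:Q) = p%:R ^ ((logn p `|b|)%:Z - (logn p `|a|)%:Z).
Proof.
move=> a0 b0; rewrite /rat_padic_norm mulf_eq0 invr_eq0 !intr_eq0.
rewrite (negPf a0) (negPf b0) /=; congr (_ ^ _).
set x := a%:Q / b%:Q.
have x0 : numq x != 0 by rewrite numq_eq0 mulf_eq0 invr_eq0 !intr_eq0 negb_or a0.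
have e : numq x * b = a * denq x.
  apply/eqP; rewrite -(@eqr_int rat) !rmorphM /=; apply/eqP.
  have bQ : b%:Q != 0 by rewrite intr_eq0.
  have dQ : (denq x)%:Q != 0 by rewrite intr_eq0 denq_neq0.
  apply: (mulIf (invr_neq0 dQ)); rewrite mulrAC divq_num_den mulfK //.
  by rewrite /x mulfVK.
have: logn p `|numq x * b| = logn p `|a * denq x| by rewrite e.
rewrite !abszM !lognM ?absz_gt0 ?denq_neq0 // => /(congr1 Posz).
rewrite !PoszD => h; apply/eqP.
by rewrite subr_eq addrAC eq_sym subr_eq addrC h addrC.
Qed.

Lemma rat_padic_norm_gt0 x : (0 < rat_padic_norm x) = (x != 0).
Proof. by rewrite /rat_padic_norm; case: eqP => //= _; rewrite exprz_gt0. Qed.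

Lemma rat_padic_norm_ge0 x : 0 <= rat_padic_norm x.
Proof.
have [->|x0] := eqVneq x 0; first by rewrite rat_padic_norm0.
by rewrite ltW // rat_padic_norm_gt0.
Qed.

Lemma rat_padic_norm_eq0 x : (rat_padic_norm x == 0) = (x == 0).
Proof. by have := rat_padic_norm_gt0 x; rewrite lt0r rat_padic_norm_ge0 andbT => /negb_inj. Qed.

Lemma rat_padic_normM : {morph rat_padic_norm : x y / x * y}.
Proof.
move=> x y; have [->|x0] := eqVneq x 0.
  by rewrite mul0r rat_padic_norm0 mul0r.
have [->|y0] := eqVneq y 0; first by rewrite mulr0 rat_padic_norm0 mulr0.
have e : x * y = (numq x * numq y)%:Q / (denq x * denq y)%:Q.
  by rewrite !rmorphM /= invfM mulrACA !divq_num_den.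
rewrite {1}e rat_padic_norm_frac ?mulf_neq0 ?numq_eq0 ?denq_neq0 //.
rewrite /rat_padic_norm (negPf x0) (negPf y0) -expfzDr //.
rewrite !abszM !lognM ?absz_gt0 ?denq_neq0 ?numq_eq0 // !PoszD opprD.
by rewrite addrACA.
Qed.

Lemma rat_padic_normV x : rat_padic_norm x^-1 = (rat_padic_norm x)^-1.
Proof.
have [->|x0] := eqVneq x 0; first by rewrite invr0 !rat_padic_norm0.
have nx : rat_padic_norm x != 0 by rewrite rat_padic_norm_eq0.
apply: (mulIf nx); rewrite -rat_padic_normM !mulVf //.
by rewrite /rat_padic_norm oner_eq0 /= logn1 subrr.
Qed.

Lemma rat_padic_normN x : rat_padic_norm (- x) = rat_padic_norm x.
Proof. by rewrite /rat_padic_norm oppr_eq0 numqN denqN abszN. Qed.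

Lemma rat_padic_normD x y :
  rat_padic_norm (x + y) <= Num.max (rat_padic_norm x) (rat_padic_norm y).
Proof.
have [->|x0] := eqVneq x 0.
  by rewrite add0r le_max lexx orbT.
have [->|y0] := eqVneq y 0; first by rewrite addr0 le_max lexx.
have [->|xy0] := eqVneq (x + y) 0.
  by rewrite rat_padic_norm0 le_max rat_padic_norm_ge0.
set d : int := denq x * denq y; have d0 : d != 0 by rewrite mulf_neq0 ?denq_neq0.
have fr z (c : int) : c != 0 -> z = (numq z * c)%:Q / (denq z * c)%:Q.
  by move=> c0; rewrite !rmorphM /= -mulf_div divff ?mulr1 ?divq_num_den ?intr_eq0.
have ex : x = (numq x * denq y)%:Q / d%:Q by rewrite /d -fr ?denq_neq0.
have ey : y = (numq y * denq x)%:Q / d%:Q.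
  by rewrite /d [denq x * denq y]mulrC -fr ?denq_neq0.
set a : int := numq x * denq y in ex; set b : int := numq y * denq x in ey.
have a0 : a != 0 by rewrite mulf_neq0 ?numq_eq0 ?denq_neq0.
have b0 : b != 0 by rewrite mulf_neq0 ?numq_eq0 ?denq_neq0.
have exy : x + y = (a + b)%:Q / d%:Q by rewrite ex ey rmorphD /= mulrDl.
have ab0 : a + b != 0.
  by apply: contraNneq xy0 => ab0; rewrite exy ab0 mul0r.
rewrite exy ex ey !rat_padic_norm_frac // le_max !ler_eXz2l //.
rewrite !lerD2l !lerN2 !lez_nat.
set m := minn (logn p `|a|%N) (logn p `|b|%N).
suff : (m <= logn p `|(a + b)%R|)%N by rewrite /m geq_min.
rewrite -pfactor_dvdn ?absz_gt0 //.
have h c : (m <= logn p `|c|)%N -> c != 0 -> ((p ^ m)%N %| c)%Z.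
  by move=> mc c0; rewrite dvdzE /= pfactor_dvdn // absz_gt0.
have : ((p ^ m)%N %| a + b)%Z by rewrite rpredD ?h ?geq_minl ?geq_minr.
by rewrite dvdzE.
Qed.

End RatPadicNorm.

Section CauchySequences.
Variables (p : nat) (pr_p : prime p).
Local Notation nrm := (rat_padic_norm p).
Implicit Types (s t : nat -> rat).

Definition padic_cauchy s : Prop := forall e : rat, 0 < e ->
  exists N, forall m n, (N <= m)%N -> (N <= n)%N -> nrm (s m - s n) < e.

Definition padic_null s : Prop := forall e : rat, 0 < e ->
  exists N, forall n, (N <= n)%N -> nrm (s n) < e.

Lemma padic_cauchy_bounded s : padic_cauchy s ->
  exists2 M, 0 < M & exists N, forall n, (N <= n)%N -> nrm (s n) < M.
Proof.
move=> /(_ 1 ltr01)[N sN]; exists (1 + nrm (s N)).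
  by rewrite ltr_pwDl // rat_padic_norm_ge0.
exists N => n Nn; have -> : s n = (s n - s N) + s N by rewrite subrK.
apply: (le_lt_trans (rat_padic_normD pr_p _ _)); rewrite gt_max.
apply/andP; split; last by rewrite ltr_pwDl.
by rewrite (lt_le_trans (sN _ _ Nn (leqnn _))) // lerDl rat_padic_norm_ge0.
Qed.

Lemma padic_cauchyB s t :
  padic_cauchy s -> padic_cauchy t -> padic_cauchy (fun n => s n - t n).
Proof.
move=> cs ct e e0; have [N sN] := cs e e0; have [M tM] := ct e e0.
exists (maxn N M) => m n; rewrite !geq_max => /andP[Nm Mm] /andP[Nn Mn].
have -> : s m - t m - (s n - t n) = (s m - s n) - (t m - t n).
  by rewrite !opprB addrACA [- t m + _]addrC addrACA [t n - _]addrC.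
apply: (le_lt_trans (rat_padic_normD pr_p _ _)).
by rewrite rat_padic_normN gt_max sN ?tM.
Qed.

Lemma padic_cauchyM s t :
  padic_cauchy s -> padic_cauchy t -> padic_cauchy (fun n => s n * t n).
Proof.
move=> cs ct e e0.
have [A A0 [NA sA]] := padic_cauchy_bounded cs.
have [B B0 [NB tB]] := padic_cauchy_bounded ct.
have [N sN] := cs (e / B) (divr_gt0 e0 B0).
have [M tM] := ct (e / A) (divr_gt0 e0 A0).
exists (maxn (maxn NA NB) (maxn N M)) => m n; rewrite !geq_max.
move=> /andP[/andP[NAm NBm] /andP[Nm Mm]] /andP[/andP[NAn NBn] /andP[Nn Mn]].
have -> : s m * t m - s n * t n = s m * (t m - t n) + (s m - s n) * t n.
  by rewrite mulrBr mulrBl addrA subrK.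
apply: (le_lt_trans (rat_padic_normD pr_p _ _)).
rewrite gt_max !rat_padic_normM //; apply/andP; split.
  rewrite -[e](divfK (lt0r_neq0 A0)) mulrC.
  by apply: ltr_pM; rewrite ?rat_padic_norm_ge0 ?tM ?sA.
rewrite -[e](divfK (lt0r_neq0 B0)).
by apply: ltr_pM; rewrite ?rat_padic_norm_ge0 ?sN ?tB.
Qed.

Lemma padic_cauchy_cst (a : rat) : padic_cauchy (fun=> a).
Proof. by move=> e e0; exists 0%N => m n _ _; rewrite subrr rat_padic_norm0. Qed.

Lemma padic_null_cauchy s : padic_null s -> padic_cauchy s.
Proof.
move=> ns e e0; have [N sN] := ns e e0; exists N => m n Nm Nn.
apply: (le_lt_trans (rat_padic_normD pr_p _ _)).
by rewrite rat_padic_normN gt_max !sN.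
Qed.

Lemma padic_norm_eventually_cst s : padic_cauchy s -> ~ padic_null s ->
  exists2 d, 0 < d & exists N, forall n, (N <= n)%N -> nrm (s n) = d.
Proof.
move=> cs /existsNP[e] /not_implyP[e0 /forallNP ns].
have [N sN] := cs e e0.
have /existsNP[k /not_implyP[Nk /negP]] := ns N; rewrite -leNgt => ek.
exists (nrm (s k)); first exact: lt_le_trans ek.
exists N => n Nn; have nk := lt_le_trans (sN _ _ Nn Nk) ek.
have kn := lt_le_trans (sN _ _ Nk Nn) ek.
have le1 : nrm (s n) <= nrm (s k).
  have -> : s n = (s n - s k) + s k by rewrite subrK.
  apply: (le_trans (rat_padic_normD pr_p _ _)); rewrite ge_max lexx.
  by rewrite (ltW nk).
apply/eqP; rewrite eq_le le1 /=.
have : nrm (s k) <= Num.max (nrm (s k - s n)) (nrm (s n)).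
  by rewrite -{1}(subrK (s n) (s k)) rat_padic_normD.
by rewrite le_max leNgt kn.
Qed.

Lemma padic_cauchyV s : padic_cauchy s -> ~ padic_null s ->
  padic_cauchy (fun n => (s n)^-1).
Proof.
move=> cs ns e e0; have [d d0 [N sN]] := padic_norm_eventually_cst cs ns.
have [M sM] := cs (e * (d * d)) (mulr_gt0 e0 (mulr_gt0 d0 d0)).
exists (maxn N M) => m n; rewrite !geq_max => /andP[Nm Mm] /andP[Nn Mn].
have s0 k : (N <= k)%N -> s k != 0.
  by move=> /sN h; rewrite -(rat_padic_norm_gt0 pr_p) h.
have -> : (s m)^-1 - (s n)^-1 = (s n - s m) / (s m * s n).
  by field; rewrite !s0.
rewrite rat_padic_normM // rat_padic_normV // rat_padic_normM // !sN //.
by rewrite ltr_pdivrMr ?mulr_gt0 // sM.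
Qed.

End CauchySequences.

(* The proof [pr_p] is an argument of these predicates so that it can be
   recovered from the types built on them. *)
Definition cauchy_seqs (p : nat) (pr_p : prime p) : {pred nat -> rat} :=
  fun s => `[< padic_cauchy p s >].

Section CauchyRing.
Variables (p : nat) (pr_p : prime p).

Lemma cauchy_seqs_subring_closed : subring_closed (cauchy_seqs pr_p).
Proof.
split; first exact/asboolP/padic_cauchy_cst.
- by move=> s t /asboolP cs /asboolP ct; exact/asboolP/padic_cauchyB.
- by move=> s t /asboolP cs /asboolP ct; exact/asboolP/padic_cauchyM.
Qed.

HB.instance Definition _ := GRing.isSubringClosed.Build _ (cauchy_seqs pr_p)
  cauchy_seqs_subring_closed.

Record cauchySeq := CauchySeq
  { cauchy_seq_val :> nat -> rat; _ : cauchy_seq_val \in cauchy_seqs pr_p }.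

HB.instance Definition _ := [isSub for cauchy_seq_val].
HB.instance Definition _ := [Choice of cauchySeq by <:].
HB.instance Definition _ := [SubChoice_isSubComNzRing of cauchySeq by <:].

Lemma cauchySeqP (s : cauchySeq) : padic_cauchy p s.
Proof. by case: s => s /= /asboolP. Qed.

Definition null_seqs : {pred cauchySeq} := fun s => `[< padic_null p s >].

Lemma null_seqs_idealr_closed : idealr_closed null_seqs.
Proof.
split.
- by apply/asboolP => e e0; exists 0%N => n _ /=; rewrite rat_padic_norm0.
- apply/asboolP => /(_ 1 ltr01)[N /(_ N (leqnn N)) /=].
  by rewrite /rat_padic_norm oner_eq0 logn1 subrr expr0z ltxx.
- move=> a s t /asboolP ns /asboolP nt; apply/asboolP => e e0.
  have [B B0 [NB aB]] := padic_cauchy_bounded pr_p (cauchySeqP a).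
  have [N sN] := ns (e / B) (divr_gt0 e0 B0); have [M tM] := nt e e0.
  exists (maxn NB (maxn N M)) => n; rewrite !geq_max => /and3P[NBn Nn Mn].
  apply: (le_lt_trans (rat_padic_normD pr_p _ _)); rewrite gt_max tM // andbT.
  rewrite rat_padic_normM // -[e](divfK (lt0r_neq0 B0)) mulrC.
  by apply: ltr_pM; rewrite ?rat_padic_norm_ge0 ?sN ?aB.
Qed.

HB.instance Definition _ := isIdealr.Build cauchySeq null_seqs
  null_seqs_idealr_closed.

(* Q_p, the completion of the rationals for the p-adic absolute value: Cauchy
   sequences modulo null sequences. *)
Definition padic := {ideal_quot null_seqs}.

HB.instance Definition _ := Choice.on padic.
HB.instance Definition _ := EqQuotient.on padic.
HB.instance Definition _ := GRing.ComNzRing.on padic.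

Lemma padic_eq (s t : cauchySeq) :
  (\pi_padic s == \pi_padic t) = (s - t \in null_seqs).
Proof. by rewrite Quotient.idealrBE. Qed.

Definition padic_inv (x : padic) : padic :=
  if x == 0 then 0 else
  \pi_padic (insubd (0 : cauchySeq) (fun n => (repr x n)^-1) : cauchySeq).

Lemma padic_mulVf x : x != 0 -> padic_inv x * x = 1.
Proof.
move=> x0; rewrite /padic_inv (negPf x0); set s := repr x.
have xE : x = \pi s by rewrite /s reprK.
have ns : ~ padic_null p s.
  move=> h; case/eqP: x0; rewrite xE -(rmorph0 \pi_padic).
  by apply/eqP; rewrite padic_eq subr0; apply/asboolP.
have iv : (fun n => (s n)^-1) \in cauchy_seqs pr_p.
  by apply/asboolP/padic_cauchyV => //; exact: cauchySeqP.
rewrite xE -rmorphM -(rmorph1 \pi_padic); apply/eqP; rewrite padic_eq.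
apply/asboolP => e e0.
have [d d0 [N sN]] := padic_norm_eventually_cst pr_p (cauchySeqP s) ns.
exists N => n /sN nd; rewrite /= insubdK //=.
have sn0 : s n != 0 by rewrite -(rat_padic_norm_gt0 pr_p) nd.
have -> : ((fun k => (s k)^-1) * (s : nat -> rat) - 1) n = 0.
  by rewrite !fctE mulVf // subrr.
by rewrite rat_padic_norm0.
Qed.

Lemma padic_inv0 : padic_inv 0 = 0.
Proof. by rewrite /padic_inv eqxx. Qed.

HB.instance Definition _ :=
  GRing.ComNzRing_isField.Build padic padic_mulVf padic_inv0.

End CauchyRing.

Section PadicNorm.
Variables (R : realType) (p : nat) (pr_p : prime p).
Local Notation nrm := (rat_padic_norm p).
Local Notation Qp := (padic pr_p).
Implicit Types (s t : cauchySeq pr_p) (x y : Qp).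

(* By [padic_norm_cvg], any representative Cauchy sequence gives this limit. *)
Definition padic_norm x : R := limn (fun n => ratr (nrm (repr x n)) : R).

Let null_cvg (u : nat -> rat) : padic_null p u ->
  (fun n => ratr (nrm (u n)) : R) @ \oo --> (0 : R).
Proof.
move=> nu; apply/cvgrPdist_lt => e e0.
have [q] := rat_in_itvoo e0; rewrite in_itv /= => /andP[q0 qe].
have {}q0 : 0 < q by rewrite -(ltr0q R).
have [N uN] := nu q q0; exists N => // n /= Nn.
rewrite sub0r normrN ger0_norm ?ler0q ?rat_padic_norm_ge0 //.
by rewrite (lt_trans _ qe) // ltr_rat uN.
Qed.

Let cauchy_cvg s : cvgn (fun n => ratr (nrm (s n)) : R).
Proof.
have [ns|ns] := pselect (padic_null p s).
  by apply/cvg_ex; exists 0; exact: null_cvg.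
have [d d0 [N sN]] := padic_norm_eventually_cst pr_p (cauchySeqP s) ns.
apply/cvg_ex; exists (ratr d); apply: cvg_near_cst.
by exists N => // n /= /sN ->.
Qed.

Let dist_nrm (a b : rat) : `|nrm a - nrm b| <= nrm (a - b).
Proof.
have h c d : nrm c - nrm d <= nrm (c - d).
  rewrite lerBlDr -{1}(subrK d c).
  apply: (le_trans (rat_padic_normD pr_p _ _)).
  by rewrite ge_max lerDl lerDr !rat_padic_norm_ge0.
by rewrite ler_norml h andbT lerNl opprB (le_trans (h _ _)) // -opprB rat_padic_normN.
Qed.

Lemma padic_norm_cvg s :
  (fun n => ratr (nrm (s n)) : R) @ \oo --> padic_norm (\pi_Qp s).
Proof.
set t : cauchySeq pr_p := repr (\pi_Qp s).
have ct := @cauchy_cvg t; rewrite /padic_norm -/t.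
have : padic_null p (fun n => s n - t n).
  suff /asboolP : s - t \in @null_seqs p pr_p by [].
  by rewrite -padic_eq /t reprK.
move=> /null_cvg st; apply: (cvg_sub0 _ ct) => /=.
apply: (@squeeze_cvgr _ _ _ _ (fun n => - (ratr (nrm (s n - t n)) : R))
  (fun n => ratr (nrm (s n - t n)) : R)) => //.
  near=> n; rewrite -ler_norml !fctE -rmorphB -ratr_norm ler_rat.
  exact: dist_nrm.
by rewrite -[0]oppr0; exact: cvgN.
Unshelve. all: by end_near. Qed.

Lemma padic_norm_ge0 x : 0 <= padic_norm x.
Proof.
apply: limr_ge; first exact: cauchy_cvg.
by near=> n; rewrite ler0q rat_padic_norm_ge0.
Unshelve. all: by end_near. Qed.

Lemma padic_norm0 : padic_norm 0 = 0.
Proof.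
rewrite -(rmorph0 \pi_Qp); apply: (cvg_unique _ (@padic_norm_cvg 0)) => //.
apply: cvg_near_cst; apply: nearW => n.
by rewrite [_ n](_ : _ = 0) // rat_padic_norm0 rmorph0.
Qed.

Lemma padic_norm_eq0 x : (padic_norm x == 0) = (x == 0).
Proof.
apply/eqP/eqP => [|->]; last exact: padic_norm0.
rewrite -[x]reprK; set s : cauchySeq pr_p := repr x => x0.
apply/eqP; rewrite -(rmorph0 \pi_Qp) padic_eq subr0; apply/asboolP.
apply: contrapT => ns; have := @padic_norm_cvg s; rewrite x0.
have [d d0 [N sN]] := padic_norm_eventually_cst pr_p (cauchySeqP s) ns.
move=> h; have : ratr d = 0 :> R.
  apply: (cvg_unique _ _ h) => //.
  by apply: cvg_near_cst; exists N => // n /= /sN ->.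
by move/eqP; rewrite fmorph_eq0 gt_eqF.
Qed.

Lemma padic_normM : {morph padic_norm : x y / x * y}.
Proof.
move=> x y; rewrite -[x]reprK -[y]reprK -rmorphM.
apply: (cvg_unique _ (@padic_norm_cvg (repr x * repr y))) => //.
rewrite (_ : (fun _ => _) = (fun n => ratr (nrm (repr x n)) * ratr (nrm (repr y n)))).
  by apply: cvgM; exact: padic_norm_cvg.
by apply/funext => n; rewrite -rmorphM -rat_padic_normM.
Qed.

Lemma padic_normN x : padic_norm (- x) = padic_norm x.
Proof.
rewrite -[x]reprK -rmorphN.
apply: (cvg_unique _ (@padic_norm_cvg (- repr x))) => //.
rewrite (_ : (fun _ => _) = (fun n => ratr (nrm (repr x n)))).
  exact: padic_norm_cvg.
by apply/funext => n; rewrite -[in RHS]rat_padic_normN.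
Qed.

Lemma padic_normD x y :
  padic_norm (x + y) <= Num.max (padic_norm x) (padic_norm y).
Proof.
rewrite -[x]reprK -[y]reprK -rmorphD; set s : cauchySeq pr_p := repr x; set t : cauchySeq pr_p := repr y.
have h : (fun n => Num.max (ratr (nrm (s n))) (ratr (nrm (t n))) : R) @ \oo -->
    Num.max (padic_norm (\pi_Qp s)) (padic_norm (\pi_Qp t)).
  apply: (continuous2_cvg _ (h := fun a b : R => Num.max a b)).
    exact: (@max_continuous _ R (_, _)).
    exact: padic_norm_cvg.
  exact: padic_norm_cvg.
apply: (ler_cvg_to (@padic_norm_cvg (s + t)) h); apply: nearW => n.
rewrite le_max !ler_rat -le_max.
exact: rat_padic_normD.
Qed.

Lemma padic_norm_neq0_gt0 x : x != 0 -> 0 < padic_norm x.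
Proof. by move=> x0; rewrite lt0r padic_norm_ge0 padic_norm_eq0 x0. Qed.

End PadicNorm.

Section ProjectiveLine.
Variable K : fieldType.

(* Homogeneous coordinates: nonzero pairs, taken up to proportionality. *)
Record hcoord := HCoord { hcoord_val :> K * K; _ : hcoord_val != (0, 0) }.

HB.instance Definition _ := [isSub for hcoord_val].
HB.instance Definition _ := [Choice of hcoord by <:].

Lemma hcoordP (a : hcoord) : (a.1 != 0) || (a.2 != 0).
Proof. by case: a => [[x y] /=]; rewrite xpair_eqE negb_and. Qed.

Definition proj_equiv (a b : hcoord) := a.1 * b.2 == b.1 * a.2.

Lemma proj_equivP (a b : hcoord) :
  reflect (exists2 k : K, k != 0 & b.1 = k * a.1 /\ b.2 = k * a.2)
          (proj_equiv a b).
Proof.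
apply: (iffP eqP) => [e|[k k0 [-> ->]]]; last by rewrite mulrCA mulrA.
have [a1|a1] := eqVneq a.1 0.
  have a2 : a.2 != 0 by have := hcoordP a; rewrite a1 eqxx.
  have b1 : b.1 = 0.
    by apply/eqP; move/eqP: e; rewrite a1 mul0r eq_sym mulf_eq0 (negPf a2) orbF.
  have b2 : b.2 != 0 by have := hcoordP b; rewrite b1 eqxx.
  exists (b.2 / a.2); first by rewrite mulf_neq0 ?invr_neq0.
  by rewrite a1 b1 mulr0 mulfVK.
have b1 : b.1 != 0.
  apply/negP => /eqP b1; have := hcoordP b; rewrite b1 eqxx /=.
  by move/eqP: e; rewrite b1 mul0r mulf_eq0 (negPf a1) /= => ->.
exists (b.1 / a.1); first by rewrite mulf_neq0 ?invr_neq0.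
by rewrite mulfVK // mulrAC -e [a.1 * _]mulrC mulfK.
Qed.

Lemma proj_equiv_refl : reflexive proj_equiv.
Proof. by move=> a; rewrite /proj_equiv. Qed.

Lemma proj_equiv_sym : symmetric proj_equiv.
Proof. by move=> a b; rewrite /proj_equiv eq_sym. Qed.

Lemma proj_equiv_trans : transitive proj_equiv.
Proof.
move=> b a c /proj_equivP[k k0 [b1 b2]] /proj_equivP[l l0 [c1 c2]].
by apply/proj_equivP; exists (l * k); rewrite ?mulf_neq0 // c1 c2 b1 b2 !mulrA.
Qed.

Canonical proj_equiv_equiv :=
  EquivRel proj_equiv proj_equiv_refl proj_equiv_sym proj_equiv_trans.

Definition proj_line := {eq_quot proj_equiv}.
HB.instance Definition _ := Choice.on proj_line.
HB.instance Definition _ := EqQuotient.on proj_line.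

Definition proj_point x y (xy : (x, y) != (0, 0)) : proj_line :=
  \pi_proj_line (HCoord xy).

End ProjectiveLine.

Section RationalMap.
Variable K : fieldType.
Implicit Types (f g : {poly K}) (r : {fraction {poly K}}) (a : hcoord K).

(* Value at (x, y) of the binary form of degree d obtained from f by
   homogenization, the sum of the f`_i X^i Y^(d - i); it is meant to be used
   with [size f <= d.+1]. *)
Definition hom_eval d f (a : K * K) : K :=
  \sum_(i < d.+1) f`_i * a.1 ^+ i * a.2 ^+ (d - i).

(* Numerator and denominator of r in lowest terms, up to a common scalar. *)
Definition ratfun_num r : {poly K} :=
  (repr r).1 %/ gcdp (repr r).1 (repr r).2.
Definition ratfun_den r : {poly K} :=
  (repr r).2 %/ gcdp (repr r).1 (repr r).2.

Definition ratfun_deg r : nat :=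
  (maxn (size (ratfun_num r)) (size (ratfun_den r))).-1.

Lemma ratfun_den_neq0 r : ratfun_den r != 0.
Proof.
have d0 := denom_ratioP (repr r).
by rewrite dvdp_div_eq0 ?dvdp_gcdr.
Qed.

Lemma ratfun_num_den r :
  r = FracField.tofrac (ratfun_num r) / FracField.tofrac (ratfun_den r).
Proof.
set n := (repr r).1; set d := (repr r).2; set q := gcdp n d.
have d0 : d != 0 := denom_ratioP (repr r).
have q0 : q != 0 by rewrite gcdp_eq0 negb_and d0 orbT.
have rE : r = FracField.tofrac n / FracField.tofrac d.
  have td0 : FracField.tofrac d != 0 by rewrite tofrac_eq0.
  apply: (mulIf td0); rewrite divfK // -{1}[r]reprK.
  rewrite !piE; apply/eqP; rewrite eqmodE /= /FracField.mulf.
  rewrite FracField.equivfE !numden_Ratio ?mulf_neq0 ?oner_neq0 ?denom_ratioP //.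
  by rewrite !mulr1 -/n -/d mulrC.
rewrite [LHS]rE; have -> : FracField.tofrac n = FracField.tofrac (ratfun_num r) * FracField.tofrac q.
  by rewrite -tofracM divpK // dvdp_gcdl.
have -> : FracField.tofrac d = FracField.tofrac (ratfun_den r) * FracField.tofrac q.
  by rewrite -tofracM divpK // dvdp_gcdr.
have tq0 : FracField.tofrac q != 0 by rewrite tofrac_eq0.
by rewrite -mulf_div (divff tq0) mulr1.
Qed.

Lemma ratfun_coprime r : coprimep (ratfun_num r) (ratfun_den r).
Proof. by apply: coprimep_div_gcd; rewrite denom_ratioP orbT. Qed.

Lemma hom_evalE d f (a : K * K) : (size f <= d.+1)%N -> a.2 != 0 ->
  hom_eval d f a = a.2 ^+ d * f.[a.1 / a.2].
Proof.
move=> fd a0; rewrite (horner_coef_wide _ fd) mulr_sumr.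
apply: eq_bigr => i _; have id : (i <= d)%N by rewrite -ltnS.
have -> : a.2 ^+ d = a.2 ^+ (d - i) * a.2 ^+ i by rewrite -exprD subnK.
by rewrite expr_div_n; field; rewrite expf_neq0.
Qed.

Lemma hom_evalE0 d f (a : K * K) : a.2 = 0 -> hom_eval d f a = f`_d * a.1 ^+ d.
Proof.
move=> a0; rewrite /hom_eval big_ord_recr /= subnn expr0 mulr1 big1 ?add0r //.
by move=> i _; rewrite a0 expr0n subn_eq0 leqNgt ltn_ord mulr0.
Qed.

Lemma ratfun_eval_neq0 r a :
  (hom_eval (ratfun_deg r) (ratfun_num r) a,
   hom_eval (ratfun_deg r) (ratfun_den r) a) != (0, 0).
Proof.
set f := ratfun_num r; set g := ratfun_den r; set d := ratfun_deg r.
have g0 : g != 0 := ratfun_den_neq0 r.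
have mE : maxn (size f) (size g) = d.+1.
  by rewrite prednK // leq_max !size_poly_gt0 g0 orbT.
have fd : (size f <= d.+1)%N by rewrite -mE leq_maxl.
have gd : (size g <= d.+1)%N by rewrite -mE leq_maxr.
rewrite xpair_eqE; apply/negP => /andP[].
have [a2|a2] := eqVneq a.2 0.
  have a1 : a.1 != 0 by have := hcoordP a; rewrite a2 eqxx orbF.
  rewrite !hom_evalE0 // !mulf_eq0 !expf_eq0 (negPf a1) !andbF !orbF.
  move=> /eqP fd0 /eqP gd0; have : size f = d.+1 \/ size g = d.+1.
    by move: mE; rewrite /maxn; case: ifP => _ ->; [right|left].
  move=> [] s.
    have : lead_coef f == 0 by rewrite lead_coefE s /= fd0.
    by rewrite lead_coef_eq0 -size_poly_eq0 s.
  have : lead_coef g == 0 by rewrite lead_coefE s /= gd0.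
  by rewrite lead_coef_eq0 -size_poly_eq0 s.
rewrite !hom_evalE // !mulf_eq0 !expf_eq0 (negPf a2) !andbF /=.
move=> rf rg; have := ratfun_coprime r; rewrite -/f -/g => cfg.
by have := coprimep_root cfg rf; rewrite rg.
Qed.

Definition ratmap r (u : proj_line K) : proj_line K :=
  proj_point (ratfun_eval_neq0 r (repr u)).

Lemma hom_evalZ d f k (a b : K * K) : b.1 = k * a.1 -> b.2 = k * a.2 ->
  hom_eval d f b = k ^+ d * hom_eval d f a.
Proof.
move=> b1 b2; rewrite /hom_eval mulr_sumr; apply: eq_bigr => i _.
have id : (i <= d)%N by rewrite -ltnS.
have -> : k ^+ d = k ^+ i * k ^+ (d - i) by rewrite -exprD subnKC.
by rewrite b1 b2 !exprMn; ring.
Qed.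

Lemma ratmapE r a :
  ratmap r (\pi a) = proj_point (ratfun_eval_neq0 r a).
Proof.
rewrite /ratmap; set b := repr _.
have /proj_equivP[k k0 [b1 b2]] : proj_equiv a b.
  by apply/(@eqquotP _ _ (proj_line K)); rewrite /b reprK.
apply/esym/(@eqquotP _ _ (proj_line K))/proj_equivP.
exists (k ^+ ratfun_deg r); first by rewrite expf_neq0.
by split; exact: hom_evalZ.
Qed.

End RationalMap.

(* P^1(Q_p) with its spherical metric; the argument R, the type in which
   distances take their values, lets the metric structure be inferred. *)
Definition padic_proj_line (R : realType) (p : nat) (pr_p : prime p) : Type :=
  proj_line (padic pr_p).

Section SphericalMetric.
Variables (R : realType) (p : nat) (pr_p : prime p).
Local Notation Qp := (padic pr_p).
Local Notation nrm := (padic_norm R).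
Implicit Types (a b c : hcoord Qp) (u v : proj_line Qp).

Definition hcoord_dist a b : R :=
  nrm (a.1 * b.2 - b.1 * a.2) /
  (Num.max (nrm a.1) (nrm a.2) * Num.max (nrm b.1) (nrm b.2)).

Definition spherical_dist u v : R := hcoord_dist (repr u) (repr v).

Let max_gt0 a : 0 < Num.max (nrm a.1) (nrm a.2).
Proof.
by rewrite lt_max; apply/orP; case/orP: (hcoordP a) => /(padic_norm_neq0_gt0 R);
  [left|right].
Qed.

Let hcoord_dist_sym a b : hcoord_dist a b = hcoord_dist b a.
Proof.
by rewrite /hcoord_dist -padic_normN opprB; congr (_ / _); exact: mulrC.
Qed.

Let hcoord_distZ a a' b : proj_equiv a a' -> hcoord_dist a' b = hcoord_dist a b.
Proof.
move=> /proj_equivP[k k0 [e1 e2]]; rewrite /hcoord_dist e1 e2.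
have -> : k * a.1 * b.2 - b.1 * (k * a.2) = k * (a.1 * b.2 - b.1 * a.2) by ring.
rewrite !padic_normM -maxr_pMr ?padic_norm_ge0 // -[X in _ / X]mulrA -mulf_div.
by rewrite divff ?mul1r // padic_norm_eq0.
Qed.

Lemma spherical_distE a b : spherical_dist (\pi a) (\pi b) = hcoord_dist a b.
Proof.
rewrite /spherical_dist.
have h c : proj_equiv c (repr (\pi_(proj_line Qp) c)).
  by apply/(@eqquotP _ _ (proj_line Qp)); rewrite reprK.
by rewrite (hcoord_distZ _ (h a)) hcoord_dist_sym (hcoord_distZ _ (h b)) hcoord_dist_sym.
Qed.

Let hcoord_dist_ultra b a c :
  hcoord_dist a c <= Num.max (hcoord_dist a b) (hcoord_dist b c).
Proof.
rewrite /hcoord_dist.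
set A := Num.max (nrm a.1) (nrm a.2); set B := Num.max (nrm b.1) (nrm b.2).
set C := Num.max (nrm c.1) (nrm c.2).
have A0 : 0 < A := max_gt0 a; have B0 : 0 < B := max_gt0 b.
have C0 : 0 < C := max_gt0 c.
set dab := a.1 * b.2 - b.1 * a.2; set dbc := b.1 * c.2 - c.1 * b.2.
set dac := a.1 * c.2 - c.1 * a.2.
have h (x y z : Qp) : z * dac = y * dab + x * dbc -> nrm y <= C -> nrm x <= A ->
    nrm z * nrm dac <= Num.max (C * nrm dab) (A * nrm dbc).
  move=> e yC xA; rewrite -padic_normM e (le_trans (padic_normD _ _ _)) //.
  rewrite !padic_normM ge_max !le_max; apply/andP; split; apply/orP.
    by left; rewrite ler_wpM2r ?padic_norm_ge0.
  by right; rewrite ler_wpM2r ?padic_norm_ge0.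
have hB : B * nrm dac <= Num.max (C * nrm dab) (A * nrm dbc).
  rewrite {1}/B; case: (leP (nrm b.1) (nrm b.2)) => _.
    by apply: (h a.2 c.2 b.2); rewrite ?/A ?/C ?le_max ?lexx ?orbT // /dac /dab /dbc; ring.
  by apply: (h a.1 c.1 b.1); rewrite ?/A ?/C ?le_max ?lexx ?orbT // /dac /dab /dbc; ring.
have ABC0 : 0 < A * B * C by rewrite !mulr_gt0.
rewrite -(ler_pM2l ABC0) [leRHS]maxr_pMr ?(ltW ABC0) //.
have -> : A * B * C * (nrm dac / (A * C)) = B * nrm dac.
  by field; rewrite !gt_eqF.
have -> : A * B * C * (nrm dab / (A * B)) = C * nrm dab.
  by field; rewrite !gt_eqF.
have -> // : A * B * C * (nrm dbc / (B * C)) = A * nrm dbc.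
by field; rewrite !gt_eqF.
Qed.

Let spherical_distxx u : spherical_dist u u = 0.
Proof. by rewrite /spherical_dist /hcoord_dist subrr padic_norm0 mul0r. Qed.

Let spherical_dist_pos u v : spherical_dist u v = 0 -> u = v.
Proof.
move=> /eqP; rewrite mulf_eq0 invr_eq0 mulf_eq0 !(gt_eqF (max_gt0 _)) !orbF.
rewrite padic_norm_eq0 subr_eq0 => uv.
by rewrite -[u]reprK -[v]reprK; apply/(@eqquotP _ _ (proj_line Qp)).
Qed.

Let spherical_dist_sym u v : spherical_dist u v = spherical_dist v u.
Proof. exact: hcoord_dist_sym. Qed.

Let hcoord_dist_ge0 a b : 0 <= hcoord_dist a b.
Proof. by rewrite divr_ge0 ?padic_norm_ge0 // ltW // mulr_gt0. Qed.

Let spherical_dist_triangle v u w :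
  spherical_dist u w <= spherical_dist u v + spherical_dist v w.
Proof.
rewrite (le_trans (hcoord_dist_ultra (repr v) _ _)) //.
by rewrite ge_max lerDl lerDr !hcoord_dist_ge0.
Qed.

HB.instance Definition _ := Choice.on (padic_proj_line R pr_p).
HB.instance Definition _ := @isMetric.Build R (padic_proj_line R pr_p)
  spherical_dist
  spherical_distxx spherical_dist_pos spherical_dist_sym spherical_dist_triangle.

End SphericalMetric.

(* An algebraic closure of F_p. *)
Definition Fp_bar (p : nat) : countClosedFieldType :=
  projT1 (countable_algebraic_closure 'F_p).

Definition Fp_bar_inj (p : nat) : {rmorphism 'F_p -> Fp_bar p} :=
  sval (projT2 (countable_algebraic_closure 'F_p)).

Section GoodReduction.
Variables (R : realType) (p : nat) (pr_p : prime p).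
Local Notation Qp := (padic pr_p).

(* Reduction modulo p; meaningful only on the p-adic integers, where the set
   below is a singleton. *)
Definition padic_red (x : Qp) : 'F_p :=
  xget 0 [set k : 'F_p | padic_norm R (x - (k : nat)%:R) < 1].

Definition poly_red (f : {poly Qp}) : {poly (Fp_bar p)} :=
  map_poly (fun x => Fp_bar_inj p (padic_red x)) f.

(* A binary form of degree d = [ratfun_deg r] is encoded by its
   dehomogenization, a univariate polynomial of size at most d.+1 with the same
   coefficients, and is evaluated by [hom_eval d]. *)
Definition good_reduction (r : {fraction {poly Qp}}) : Prop :=
  exists F G : {poly Qp},
    [/\ [/\ (size F <= (ratfun_deg r).+1)%N, (size G <= (ratfun_deg r).+1)%N,
            G != 0 & r = FracField.tofrac F / FracField.tofrac G],
        forall i, padic_norm R F`_i <= 1 /\ padic_norm R G`_i <= 1,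
        exists i, padic_norm R F`_i = 1 \/ padic_norm R G`_i = 1
      & forall u : proj_line (Fp_bar p),
          ~ (hom_eval (ratfun_deg r) (poly_red F) (repr u) = 0 /\
             hom_eval (ratfun_deg r) (poly_red G) (repr u) = 0)].

End GoodReduction.

Section Disjointness.
Variable R : realType.
Implicit Types c : nat -> R[i].
Local Open Scope complex_scope.

(* Sequences are indexed from 1: the term c 0 is never used. *)

Definition cexpi (t : R) : R[i] := cos t +i* sin t.

Definition oscillating c : Prop := forall t : R, 0 <= t < 1 ->
  (fun N => N%:R^-1 * \sum_(1 <= n < N.+1) c n * cexpi (- (2 * pi * n%:R * t))
     : R[i]^o) @ \oo --> (0 : R[i]^o).

Definition growth_condition c : Prop := exists2 lambda : R, 1 < lambda &
  (fun N => \sum_(1 <= n < N.+1) Normc.normc (c n) `^ lambda : R^o)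
    =O_\oo (fun N => N%:R : R^o).

Definition linearly_disjoint (X : metricType R) (T : X -> X) c : Prop :=
  forall f : X -> R[i]^o, continuous f -> forall x : X,
  (fun N => N%:R^-1 * \sum_(1 <= n < N.+1) c n * f (iter n T x)
     : R[i]^o) @ \oo --> (0 : R[i]^o).

End Disjointness.

(* The self-map of P^1(Q_p) induced by r : Q_p(x). *)
Definition padic_ratmap (R : realType) (p : nat) (pr_p : prime p)
    (r : {fraction {poly padic pr_p}}) :
    padic_proj_line R pr_p -> padic_proj_line R pr_p :=
  ratmap r.

(* Main.v *)
Require Import Defs.
From HB Require Import structures.
From mathcomp Require Import all_boot all_order all_algebra.
From mathcomp Require Import generic_quotient fraction complex.
From mathcomp Require Import ring lra.
From mathcomp Require Import all_classical all_reals all_analysis.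

(** A rational map with good reduction does not increase the spherical distance
    of the projective line over Q_p, this line is compact, and its distance is
    ultrametric; these three facts suffice.

    Dynamics.  Let T be a nonexpanding self-map of a compact ultrametric space
    and d > 0.  By compactness an orbit contains two points less than d apart,
    say at times i and i + q.  Nonexpansion carries this return along the orbit
    and the ultrametric inequality keeps the errors of successive returns from
    adding up, so that from time i on the orbit is q-periodic up to d
    ([orbit_almost_periodic]).  A continuous f is uniformly continuous, so
    n |-> f (T^n x) is, for n large, uniformly close to a periodic sequence.

    Averages.  A periodic sequence is a linear combination of the characters
    n |-> exp (-2 i pi n j / q), so an oscillating sequence c averages to zero
    against it ([oscillating_periodic]).  The growth condition bounds the means
    of |c|, since x <= 1 + x^lambda; hence uniform approximation is harmless
    ([mean_zero_approx]).

    Geometry.  Give each point of the projective line homogeneous coordinates of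
    maximal norm 1; the distance of a and b is then |a1 b2 - b1 a2|.
    Compactness comes from the density of the natural numbers in Z_p, which
    leaves finitely many classes modulo p^k, and from completeness
    ([compact_proj_line]).  Let R = [F : G] have good reduction.  At normalized
    coordinates a the pair (F(a), G(a)) is normalized too, as otherwise the
    reduction of a would be a common zero of the reduced forms
    ([hom_eval_normalized]).  So the distance of the images of a and b is
    |F(a) G(b) - F(b) G(a)|, and the polynomial inside is a multiple, over Z_p,
    of a1 b2 - b1 a2 ([hom_eval_bracket_le]). *)

Set Implicit Arguments.
Unset Strict Implicit.
Unset Printing Implicit Defensive.

Import Order.TTheory GRing.Theory Num.Theory numFieldNormedType.Exports.

Local Open Scope classical_set_scope.
Local Open Scope ring_scope.

(** * Characters of finite cyclic groups *)

Section RootsOfUnity.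
Local Open Scope complex_scope.
Variable R : realType.
Implicit Types s t : R.

Lemma cexpiD s t : cexpi (s + t) = cexpi s * cexpi t.
Proof. by rewrite /cexpi cosD sinD; simpc; rewrite [sin s * _ + _]addrC. Qed.

Lemma cexpi0 : cexpi 0 = 1 :> R[i].
Proof. by rewrite /cexpi cos0 sin0. Qed.

Lemma cexpiMn t n : cexpi (t *+ n) = cexpi t ^+ n.
Proof.
by elim: n => [|n IH]; rewrite ?mulr0n ?cexpi0// mulrS cexpiD IH exprS.
Qed.

Lemma cexpiN t : cexpi (- t) = (cexpi t)^-1.
Proof.
have h : cexpi t * cexpi (- t) = 1 by rewrite -cexpiD subrr cexpi0.
have u0 : cexpi t != 0.
  by apply/eqP => u0; move: h; rewrite u0 mul0r => /esym/eqP; rewrite oner_eq0.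
by apply: (mulfI u0); rewrite h mulfV.
Qed.

(** The real part is 1 - 2 sin^2 (t / 2), and the sine is positive inside a
    half period. *)
Lemma cexpi_neq1 t : 0 < t < 2 * pi -> cexpi t != 1.
Proof.
move=> /andP[t0 tpi]; apply/eqP => /(congr1 (@complex.Re R)) /=.
have -> : t = t / 2 + t / 2 by rewrite -splitr.
have s0 : 0 < sin (t / 2).
  by apply: sin_gt0_pi; rewrite divr_gt0//= ltr_pdivrMr// mulrC.
have := cos2Dsin2 (t / 2); rewrite cosD; nra.
Qed.

Lemma cexpi_primitive_root q : (0 < q)%N ->
  q.-primitive_root (cexpi (2 * pi / q%:R : R)).
Proof.
move=> q0; have q0R : 0 < q%:R :> R by rewrite ltr0n.
apply/andP; split=> //; apply/forallP => i; apply/eqP.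
rewrite unity_rootE -cexpiMn -[_ *+ i.+1]mulr_natr.
have [->|iq] := eqVneq i.+1 q.
  by rewrite divfK ?(gt_eqF q0R)// /cexpi mulr_natl cos2pi sin2pi eqxx.
apply/negbTE/cexpi_neq1; have pi0 := pi_gt0 R.
rewrite !mulr_gt0 ?invr_gt0 ?ltr0n//= -mulrA gtr_pMr ?mulr_gt0//.
by rewrite mulrC ltr_pdivrMr// mul1r ltr_nat ltn_neqAle iq ltn_ord.
Qed.

End RootsOfUnity.

(** Orthogonality of the characters of Z/qZ: if n and m differ modulo q, the
    terms are the successive powers of a q-th root of unity other than 1. *)
Lemma mod_eq_indicator (K : fieldType) (q : nat) (z : K) (m n : nat) :
  q.-primitive_root z -> q%:R != 0 :> K ->
  (n == m %[mod q])%:R =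
    q%:R^-1 * \sum_(j < q) z ^+ (j * m) * z^-1 ^+ (n * j).
Proof.
move=> zq q0.
have z0 : z != 0.
  apply/eqP => z0; have := prim_expr_order zq; rewrite z0 expr0n.
  by rewrite gtn_eqF ?(prim_order_gt0 zq)// => /esym/eqP; rewrite oner_eq0.
set w := z ^+ m / z ^+ n.
have wq : w ^+ q = 1.
  rewrite /w expr_div_n -!exprM !(mulnC _ q) !exprM (prim_expr_order zq).
  by rewrite !expr1n divr1.
rewrite (eq_bigr (fun j : 'I_q => w ^+ j)); last first.
  move=> j _; rewrite /w expr_div_n -!exprM; congr (_ * _).
    by rewrite mulnC.
  by rewrite exprVn.
rewrite -(eq_prim_root_expr zq).
have [nm|nm] := eqVneq (z ^+ n) (z ^+ m).
  rewrite (eq_bigr (fun=> 1)); last first.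
    by move=> j _; rewrite /w nm divff ?expf_neq0// expr1n.
  by rewrite sumr_const card_ord mulVf.
have w1 : w - 1 != 0.
  rewrite subr_eq0; apply: contra nm => /eqP w1.
  rewrite eq_sym -subr_eq0 -[z ^+ m](divfK (expf_neq0 n z0)) -/w w1.
  by rewrite mul1r subrr.
by apply/esym/eqP; rewrite mulf_eq0; apply/orP; right;
  rewrite -(mulrI_eq0 _ (mulfI w1)) -subrX1 wq subrr.
Qed.

(** * Averages against oscillating sequences *)

Section Averages.
Local Open Scope complex_scope.
Variable R : realType.
Implicit Types (c u v : nat -> R[i]).

Definition mean u (N : nat) : R[i]^o := N%:R^-1 * \sum_(1 <= n < N.+1) u n.

Definition mean_zero u : Prop := mean u @ \oo --> (0 : R[i]^o).

Lemma eq_mean_zero u v : u =1 v -> mean_zero u -> mean_zero v.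
Proof. by move=> /funext ->. Qed.

Lemma mean_zeroZ (a : R[i]) u : mean_zero u -> mean_zero (fun n => a * u n).
Proof.
move=> mu; rewrite /mean_zero -[X in _ --> X](mulr0 (a : R[i]^o)).
rewrite (_ : mean _ = (fun N => (a : R[i]^o) * mean u N)).
  exact: cvgM (cvg_cst _) mu.
by apply/funext => N; rewrite /mean -mulr_sumr mulrCA.
Qed.

Lemma mean_zero_sum (q : nat) (u : 'I_q -> nat -> R[i]) :
  (forall j, mean_zero (u j)) -> mean_zero (fun n => \sum_(j < q) u j n).
Proof.
move=> mu; rewrite /mean_zero.
rewrite (_ : mean _ = (fun N => \sum_(j < q) mean (u j) N)).
  rewrite [X in _ --> X](_ : _ = \sum_(j < q) (0 : R[i]^o)); last first.
    by rewrite big1.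
  by apply: cvg_big => [|j _]; [exact: add_continuous|exact: mu].
by apply/funext => N; rewrite /mean exchange_big mulr_sumr.
Qed.

(** A periodic weight is a linear combination of the characters n |-> z^(-jn)
    of Z/qZ, and each of those has a rational frequency. *)
Lemma oscillating_periodic c (q : nat) (g : nat -> R[i]) :
  oscillating c -> (0 < q)%N ->
  (forall n, g n = g (n %% q)%N) -> mean_zero (fun n => c n * g n).
Proof.
move=> osc q0 gq; have qR0 : 0 < q%:R :> R by rewrite ltr0n.
set z := cexpi (2 * pi / q%:R : R); have zq := cexpi_primitive_root R q0.
have q0C : q%:R != 0 :> R[i] by rewrite pnatr_eq0 -lt0n.
apply: (@eq_mean_zero (fun n => \sum_(m < q) g m * (q%:R^-1 *
  \sum_(j < q) z ^+ (j * m) * (c n * z^-1 ^+ (n * j))))).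
  move=> n; rewrite gq (bigD1 (Ordinal (ltn_pmod n q0)))//=.
  rewrite [X in _ + X]big1; last first.
    move=> [m mq] mn; under eq_bigr do rewrite mulrCA.
    rewrite -mulr_sumr [q%:R^-1 * _]mulrCA -(mod_eq_indicator m n zq)//.
    rewrite -(inj_eq val_inj)/= eq_sym in mn.
    by rewrite [(m %% q)%N]modn_small// (negPf mn) !mulr0.
  under eq_bigr do rewrite mulrCA.
  rewrite -mulr_sumr [q%:R^-1 * _]mulrCA -(mod_eq_indicator _ n zq)//.
  by rewrite modn_mod eqxx mulr1 addr0 mulrC.
apply: mean_zero_sum => m; do 2!apply: mean_zeroZ.
apply: mean_zero_sum => j; apply: mean_zeroZ.
have jq : 0 <= (j%:R / q%:R : R) < 1.
  by rewrite divr_ge0//= ltr_pdivrMr// mul1r ltr_nat.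
apply: eq_mean_zero (osc (j%:R / q%:R) jq : mean_zero _) => n.
rewrite -cexpiN -cexpiMn; congr (c n * cexpi _).
by rewrite -[RHS]mulr_natr natrM; ring.
Qed.

(** Pointwise x <= 1 + x ^ lambda. *)
Lemma growth_condition_L1 c : growth_condition c ->
  exists C : R, 0 < C /\ \forall N \near \oo,
    \sum_(1 <= n < N.+1) `|c n| <= (C * N%:R)%:C.
Proof.
move=> [l l1 /eqO_exP[k k0 kc]]; exists (1 + k); split; first lra.
near=> N.
rewrite (_ : \sum_(1 <= n < N.+1) `|c n| =
    (\sum_(1 <= n < N.+1) Normc.normc (c n))%:C); last by rewrite rmorph_sum.
rewrite lecR.
have : `|\sum_(1 <= n < N.+1) Normc.normc (c n) `^ l| <= k * `|N%:R : R|.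
  by near: N; exact: kc.
rewrite ger0_norm ?sumr_ge0//; last by move=> ? _; exact: powR_ge0.
rewrite normr_nat mulrDl mul1r => h.
rewrite (le_trans _ (lerD (lexx _) h))//.
rewrite (_ : N%:R = \sum_(1 <= n < N.+1) 1); last first.
  by rewrite sumr_const_nat subn1.
rewrite -big_split/=; apply: ler_sum => n _.
set x := Normc.normc _.
have [x1|x1] := leP x 1; first by rewrite (le_trans x1)// lerDl powR_ge0.
rewrite -{1}[x](powRr1 (ltW (lt_trans ltr01 x1))).
by rewrite (le_trans (ler_powR (ltW x1) (ltW l1)))// lerDr.
Unshelve. all: by end_near. Qed.

(** Replacing f by g costs e times the mean of |c|, which is bounded, plus the
    finitely many terms where f and g are not close, which the factor 1 / N
    kills. *)
Lemma mean_zero_approx c (C : R) (f : nat -> R[i]) : 0 < C ->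
  (\forall N \near \oo, \sum_(1 <= n < N.+1) `|c n| <= (C * N%:R)%:C) ->
  (forall e : R, 0 < e -> exists g : nat -> R[i],
     mean_zero (fun n => c n * g n) /\
     \forall n \near \oo, `|f n - g n| <= e%:C) ->
  mean_zero (fun n => c n * f n).
Proof.
move=> C0 cC fg; apply/cvgr0Pnorm_lt => eC eC0.
have eE : eC = (complex.Re eC)%:C.
  by apply/esym/RRe_real; rewrite realE (ltW eC0).
move: eC0; rewrite eE; set e := complex.Re eC; rewrite ltcR => e0 {eE}.
have eC3 : 0 < e / (3 * C) by rewrite divr_gt0// mulr_gt0.
have [g [mg [i _ ig]]] := fg _ eC3.
(* K bounds the contribution of the indices where f and g may be far apart;
   it does not depend on N. *)
set K := \sum_(1 <= n < i.+1) Normc.normc (c n * (f n - g n)).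
have K0 : 0 <= K.
  by apply: sumr_ge0 => n _; rewrite -lecR (normr_ge0 (c n * (f n - g n))).
have e3 : 0 < (e / 3)%:C by rewrite ltcR; lra.
near=> N.
have N0 : 0 < N%:R :> R by rewrite ltr0n; near: N; exact: nbhs_infty_gt.
have iN : (i <= N)%N by near: N; exact: nbhs_infty_ge.
have KN : K <= e / 3 * N%:R.
  rewrite mulrC -ler_pdivrMr; last lra.
  by near: N; exact: nbhs_infty_ger.
have mN : `|mean (fun n => c n * g n) N| < (e / 3)%:C.
  by near: N; move/cvgr0Pnorm_lt : mg; apply.
have cN : \sum_(1 <= n < N.+1) `|c n| <= (C * N%:R)%:C by near: N.
have -> : mean (fun n => c n * f n) N =
    mean (fun n => c n * g n) N + mean (fun n => c n * (f n - g n)) N.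
  rewrite /mean -mulrDr -big_split; congr (_ * _); apply: eq_bigr => n _ /=.
  by rewrite mulrBr addrC subrK.
rewrite (le_lt_trans (ler_normD _ _))//.
have -> : e%:C = (e / 3)%:C + (2 * e / 3)%:C.
  by rewrite -rmorphD/=; congr _%:C; lra.
apply: ltr_leD => //.
have -> : (2 * e / 3)%:C = N%:R^-1 * (2 * e / 3 * N%:R)%:C.
  rewrite [in RHS]rmorphM/= rmorph_nat mulrCA mulVf ?mulr1//.
  by rewrite pnatr_eq0 -lt0n -(ltr0n R).
rewrite /mean normrM normfV normr_nat ler_wpM2l ?invr_ge0 ?ler0n//.
rewrite (le_trans (ler_norm_sum _ _ _))// (@big_cat_nat _ _ _ i.+1)//=.
have -> : (2 * e / 3 * N%:R)%:C = (e / 3 * N%:R)%:C + (e / 3 * N%:R)%:C.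
  by rewrite -rmorphD/=; congr _%:C; lra.
apply: lerD; first by rewrite -rmorph_sum lecR.
apply: (@le_trans _ _ (\sum_(i.+1 <= n < N.+1) (e / (3 * C))%:C * `|c n|)).
  rewrite big_nat_cond [leRHS]big_nat_cond.
  apply: ler_sum => n /andP[/andP[ni _] _].
  by rewrite normrM mulrC ler_wpM2r// ig//= ltnW.
rewrite -mulr_sumr.
have -> : (e / 3 * N%:R)%:C = (e / (3 * C))%:C * (C * N%:R)%:C.
  by rewrite -rmorphM/=; congr _%:C; field; rewrite gt_eqF.
rewrite ler_wpM2l ?lecR ?divr_ge0 ?mulr_ge0 ?(ltW e0) ?(ltW C0)//.
rewrite (le_trans _ cN)// [leRHS](@big_cat_nat _ _ _ i.+1)//= lerDr.
by rewrite sumr_ge0.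
Unshelve. all: by end_near. Qed.

End Averages.

(** * Nonexpanding maps of compact ultrametric spaces *)

Section UltrametricFlow.
Local Open Scope complex_scope.
Variables (R : realType) (X : metricType R) (T : X -> X).
Hypothesis compactX : compact [set: X].
Hypothesis ultraX : forall y x z : X,
  mdist x z <= Num.max (mdist x y) (mdist y z).
Hypothesis nonexpanding : forall x y : X, mdist (T x) (T y) <= mdist x y.

(** The nearby points and the small radii on which f varies by less than e cover
    the space; by compactness one radius is good at all points. *)
Lemma compact_unif_cont (f : X -> R[i]^o) : continuous f ->
  forall e : R, 0 < e -> exists2 d : R, 0 < d &
    forall x y, mdist x y < d -> `|f x - f y| < e%:C.
Proof.
move=> cf e e0; have := compactX; rewrite compact_near_coveringP => cov.
have e20 : 0 < (e / 2)%:C by rewrite ltcR divr_gt0.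
have [x _|d /= d0 dP] := cov _ (0^'+ : set_system R)
    (fun d x => forall y, mdist x y < d -> `|f x - f y| < e%:C) _.
  have /nbhs_ballP[r /= r0 fr] : \forall y \near x, `|f x - f y| < (e / 2)%:C.
    by move/cvgrPdist_lt : (cf x); apply.
  exists (ball x (r / 2), [set d | d < r / 2]) => /=.
    split; first by apply: nbhsx_ballx; rewrite divr_gt0.
    by apply: nbhs_right_lt; rewrite divr_gt0.
  move=> [x' d] /= [xx' dr] y x'y.
  have fx' : `|f x - f x'| < (e / 2)%:C.
    by apply: fr; apply: le_ball xx'; lra.
  have fy : `|f x - f y| < (e / 2)%:C.
    apply: fr; rewrite [r]splitr; apply: ball_triangle xx' _.
    by rewrite ballEmdist/= (lt_trans x'y).
  rewrite -[f x'](subrK (f x)) -addrA (le_lt_trans (ler_normD _ _))//.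
  by rewrite [e]splitr rmorphD/= ltrD// distrC.
exists (d / 2) => [|x y xy]; first by rewrite divr_gt0.
by apply: (dP (d / 2)) xy => //=; rewrite ?divr_gt0//
  sub0r normrN gtr0_norm ?divr_gt0//; lra.
Qed.

(** An orbit in a compact space has a cluster point, hence visits some ball
    infinitely often. *)
Lemma orbit_return (x : X) (d : R) : 0 < d ->
  exists i q, (0 < q)%N /\ mdist (iter i T x) (iter (i + q) T x) < d.
Proof.
move=> d0; have [p [_ pP]] := compactX (fmap_proper_filter
  (fun n => iter n T x) (eventually_filter)) filterT.
have visit (N : nat) : exists2 n, (N <= n)%N & ball p d (iter n T x).
  have [|_ [[n Nn <-] pn]] := pP ((fun n => iter n T x) @` [set n | (N <= n)%N])
      (ball p d) _ (nbhsx_ballx _ _ d0).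
    by exists N => // n Nn; exists n.
  by exists n.
have [i _ pi] := visit 0%N; have [j ij pj] := visit i.+1.
exists i, (j - i)%N; split; first by rewrite subn_gt0.
rewrite subnKC; last exact: ltnW.
rewrite (le_lt_trans (ultraX p _ _))// gt_max metric_sym.
by move: pi pj; rewrite ballEmdist/= => -> ->.
Qed.

(** Since T does not increase distances, a return within d repeats for ever;
    since the distance is ultrametric, being within d is transitive, so the
    errors of successive returns do not add up. *)
Lemma orbit_almost_periodic (x : X) (d : R) : 0 < d ->
  exists i q, (0 < q)%N /\ forall m n, (i <= m)%N -> (i <= n)%N ->
    m = n %[mod q] -> mdist (iter m T x) (iter n T x) < d.
Proof.
move=> d0; have [i [q [q0 iq]]] := orbit_return x d0.
have step k : mdist (iter (i + k) T x) (iter (i + k + q) T x) < d.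
  elim: k => [|k]; first by rewrite addn0.
  by rewrite addnS addSn !iterS; exact: le_lt_trans.
have steps j k : mdist (iter (i + j) T x) (iter (i + j + k * q) T x) < d.
  elim: k => [|k IH]; first by rewrite mul0n addn0 mdistxx.
  rewrite (le_lt_trans (ultraX (iter (i + j + k * q) T x) _ _))// gt_max IH/=.
  by rewrite mulSnr addnA -(addnA i) step.
exists i, q; split=> // m n im jn.
wlog mn : m n im jn / (m <= n)%N => [th|].
  case/orP: (leq_total m n) => [/th|nm e]; first exact.
  by rewrite metric_sym th.
move/esym/eqP; rewrite eqn_mod_dvd// => /dvdnP[k nmk].
by rewrite -(subnKC mn) nmk -(subnKC im) steps.
Qed.

(** Along the orbit, f is uniformly close to a periodic sequence, against which
    an oscillating sequence averages to zero. *)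
Lemma nonexpanding_linearly_disjoint (c : nat -> R[i]) :
  oscillating c -> growth_condition c -> linearly_disjoint T c.
Proof.
move=> osc /growth_condition_L1[C [C0 cC]] f cf x.
apply: (mean_zero_approx C0 cC) => e e0.
have [d d0 fd] := compact_unif_cont cf e0.
have [i [q [q0 per]]] := orbit_almost_periodic x d0.
(* i * q + n %% q is the index congruent to n in a period past time i. *)
exists (fun n => f (iter (i * q + n %% q) T x)); split.
  by apply: (oscillating_periodic osc q0) => n; rewrite modn_mod.
exists i => // n /= ni; apply/ltW/fd/per => //.
  by rewrite (leq_trans _ (leq_addr _ _))// leq_pmulr.
by rewrite modnMDl modn_mod.
Qed.

End UltrametricFlow.

(** * Approximation of p-adic integers by natural numbers *)

(** Bernoulli: k (a - 1) <= a ^ k. *)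
Lemma exp_inv_small (K : archiRealFieldType) (a e : K) : 1 < a -> 0 < e ->
  exists k, a ^- k < e.
Proof.
move=> a1 e0; have a0 : 0 < a by rewrite (lt_trans ltr01).
have h : e^-1 * (a - 1)^-1 < (Num.bound (e^-1 * (a - 1)^-1))%:R.
  by rewrite archi_boundP// mulr_ge0 ?invr_ge0 ?subr_ge0 ?ltW.
set k := Num.bound _ in h; exists k.
rewrite -[e]invrK ltf_pV2 ?posrE ?invr_gt0 ?exprn_gt0//.
move: h; rewrite ltr_pdivrMr ?subr_gt0// => /lt_le_trans; apply.
elim: k => [|k IH]; first by rewrite mul0r expr0 ler01.
rewrite exprS -natr1 mulrDl mul1r.
have : 1 <= a ^+ k by rewrite exprn_ege1// ltW.
nra.
Qed.

Section RatApprox.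
Variables (p : nat) (pr_p : prime p).
Local Notation nrm := (rat_padic_norm p).

Let pQ_gt1 : 1 < p%:R :> rat. Proof. by rewrite ltr1n prime_gt1. Qed.
Let pQ_gt0 : 0 < p%:R :> rat. Proof. exact: lt_trans ltr01 _. Qed.

Lemma rat_padic_norm_nat n : (0 < n)%N -> nrm n%:R = p%:R ^- logn p n.
Proof.
move=> n0; rewrite -[n%:R]divr1 -[1]/(1%:Q) -[n%:R]/(n%:Z%:Q).
rewrite rat_padic_norm_frac ?intr_eq0 -?lt0n// ?eqz_nat -?lt0n//.
by rewrite logn1 sub0r -invr_expz.
Qed.

Lemma rat_padic_norm_nat_le1 n : nrm n%:R <= 1.
Proof.
case: n => [|n]; first by rewrite rat_padic_norm0 ler01.
by rewrite rat_padic_norm_nat// invf_le1 ?exprn_gt0// exprn_ege1// ltW.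
Qed.

Lemma rat_padic_norm_nat_lt1 n : (nrm n%:R < 1) = (p %| n)%N.
Proof.
case: n => [|n]; first by rewrite rat_padic_norm0 ltr01 dvdn0.
rewrite rat_padic_norm_nat// invf_lt1 ?exprn_gt0// -[p in RHS]expn1.
rewrite pfactor_dvdn//.
by case: logn => [|k]; rewrite ?ltxx// exprn_egt1.
Qed.

Lemma rat_padic_norm_int_le1 (m : int) : nrm m%:Q <= 1.
Proof.
case: m => n; first exact: rat_padic_norm_nat_le1.
by rewrite NegzE rmorphN/= rat_padic_normN rat_padic_norm_nat_le1.
Qed.

(** Lowest terms: a denominator divisible by p would make the norm exceed 1,
    so the denominator is invertible modulo p ^ k and n solves n b = a there. *)
Lemma rat_padic_approx (q : rat) k : nrm q <= 1 ->
  exists2 n, (n < p ^ k)%N & nrm (q - n%:R) <= p%:R ^- k.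
Proof.
move=> q1; set a := numq q; set b := denq q.
have b0 : b%:Q != 0 by rewrite intr_eq0 denq_neq0.
have bE : b = `|b|%N%:Z by rewrite gez0_abs// denq_ge0.
have cab : coprime `|a| `|b| := coprime_num_den q.
have pb : ~~ (p %| `|b|)%N.
  apply/negP => pb; have pa : coprime p `|a|.
    by rewrite coprime_sym (coprime_dvdr pb).
  have q0 : q != 0.
    apply: contraTneq pa => q0.
    by rewrite /a q0 /coprime gcdn0 gtn_eqF// prime_gt1.
  move: q1; rewrite /rat_padic_norm (negPf q0) -/a -/b (logn_coprime pa) subr0.
  have v0 : logn p `|b| != 0%N.
    by rewrite -lt0n logn_gt0 mem_primes pr_p absz_gt0 denq_neq0.
  by rewrite -exprnP leNgt exprn_egt1// v0.
have nb1 : nrm b%:Q = 1.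
  have b1 : (0 < `|b|)%N by rewrite absz_gt0 denq_neq0.
  rewrite bE [nrm _](rat_padic_norm_nat b1).
  by rewrite logn_coprime ?expr0 ?invr1// prime_coprime.
set P : int := (p ^ k)%N.
have P0 : P != 0 by rewrite eqz_nat expn_eq0 eqn0Ngt prime_gt0.
have [[u v] /= uv] : exists uv : int * int, uv.1 * b + uv.2 * P = 1.
  have : coprimez b P.
    by rewrite bE coprimezE/= coprime_sym coprimeXl// prime_coprime.
  by move=> /coprimezP[uv]; exists uv.
have nE : `|((a * u) %% P)%Z|%N%:Z = ((a * u) %% P)%Z.
  by rewrite gez0_abs// modz_ge0.
exists `|((a * u) %% P)%Z|%N.
  by rewrite -ltz_nat nE ltz_mod.
rewrite -[X in q - X]/(`|((a * u) %% P)%Z|%N%:Z%:Q) nE.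
have -> : q - ((a * u) %% P)%Z%:Q =
    P%:Q * (a * v + ((a * u) %/ P)%Z * b)%:Q / b%:Q.
  apply: (mulIf b0); rewrite divfK// mulrBl -{1}(divq_num_den q) divfK//.
  rewrite -!rmorphM -rmorphB; congr _%:~R; rewrite -/a.
  have -> : ((a * u) %% P)%Z = a * u - ((a * u) %/ P)%Z * P.
    by rewrite {2}(divz_eq (a * u) P) addrC addKr.
  by set t := ((a * u) %/ P)%Z; rewrite -[X in X - _]mulr1 -uv; ring.
rewrite !rat_padic_normM// rat_padic_normV// nb1 invr1 mulr1.
rewrite {1}/P rat_padic_norm_nat ?expn_gt0 ?prime_gt0// pfactorK//.
by rewrite ler_piMr ?rat_padic_norm_int_le1// invr_ge0 exprn_ge0// ltW.
Qed.

End RatApprox.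

Section PadicIntegers.
Local Open Scope quotient_scope.
Variables (R : realType) (p : nat) (pr_p : prime p).
Local Notation nrm := (rat_padic_norm p).
Local Notation Qp := (padic pr_p).
Local Notation "`| x |_p" := (padic_norm R x) (at level 0, x at level 99).
Implicit Types (s t : cauchySeq pr_p) (x y : Qp).

Lemma cauchySeq_natE n k : (n%:R : cauchySeq pr_p) k = n%:R.
Proof. by elim: n => [//|n IH]; rewrite -natr1 -[in RHS]natr1 -IH. Qed.

Lemma padic_norm_pi_le s (e : rat) :
  (exists N, forall n, (N <= n)%N -> nrm (s n) <= e) ->
  `| \pi_Qp s |_p <= ratr e.
Proof.
move=> [N sN]; apply: (cvgr_to_le (@padic_norm_cvg R _ _ s)).
by exists N => // n /= /sN; rewrite ler_rat.
Qed.

(** Unless the sequence tends to 0, the norms of its terms are eventually equal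
    to the norm of its limit. *)
Lemma padic_norm_pi_le1 s : `| \pi_Qp s |_p <= 1 ->
  exists N, forall n, (N <= n)%N -> nrm (s n) <= 1.
Proof.
move=> s1; have [/(_ 1 ltr01)[N sN]|ns] := pselect (padic_null p s).
  by exists N => n /sN/ltW.
have [d d0 [N sN]] := padic_norm_eventually_cst pr_p (cauchySeqP s) ns.
exists N => n /[dup] nN /sN ->; rewrite -(ler_rat R) rmorph1.
apply: le_trans s1; apply: (cvgr_to_ge (@padic_norm_cvg R _ _ s)).
by exists N => // m /= /sN ->.
Qed.

Lemma padic_norm_natB m n :
  `| (m%:R - n%:R : Qp) |_p = ratr (nrm (m%:R - n%:R)).
Proof.
rewrite -!(rmorph_nat \pi_Qp) -rmorphB.
apply: (cvg_unique _ (@padic_norm_cvg R p pr_p (m%:R - n%:R))) => //.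
apply: cvg_near_cst; apply: nearW => k.
by rewrite -(cauchySeq_natE m k) -(cauchySeq_natE n k).
Qed.

Lemma padic_norm_nat n : `| (n%:R : Qp) |_p = ratr (nrm n%:R).
Proof. by rewrite -[n%:R]subr0 (padic_norm_natB n 0) subr0. Qed.

Lemma padic_norm_nat_le1 n : `| (n%:R : Qp) |_p <= 1.
Proof.
have := rat_padic_norm_nat_le1 pr_p n.
by rewrite padic_norm_nat -(ler_rat R) rmorph1.
Qed.

Lemma padic_norm_nat_lt1 n : (`| (n%:R : Qp) |_p < 1) = (p %| n)%N.
Proof.
rewrite -(rat_padic_norm_nat_lt1 pr_p) padic_norm_nat.
by rewrite -[RHS](ltr_rat R) rmorph1.
Qed.

Lemma padic_norm1 : `| (1 : Qp) |_p = 1.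
Proof.
by rewrite (padic_norm_nat 1) rat_padic_norm_nat// logn1 expr0 invr1 rmorph1.
Qed.

Lemma padic_normD_le (e : R) x y :
  `| x |_p <= e -> `| y |_p <= e -> `| x + y |_p <= e.
Proof. by move=> xe ye; rewrite (le_trans (padic_normD _ _ _))// ge_max xe. Qed.

Lemma padic_normB_le (e : R) x y :
  `| x |_p <= e -> `| y |_p <= e -> `| x - y |_p <= e.
Proof. by move=> xe ye; rewrite padic_normD_le// padic_normN. Qed.

Lemma padic_distrC x y : `| x - y |_p = `| y - x |_p.
Proof. by rewrite -padic_normN opprB. Qed.

Lemma padic_dist_le (e : R) z x y :
  `| x - z |_p <= e -> `| y - z |_p <= e -> `| x - y |_p <= e.
Proof.
move=> xe ye; have -> : x - y = (x - z) - (y - z) by ring.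
exact: padic_normB_le.
Qed.

(** A rational number close to x is in Z_p as well, where the natural numbers
    below p ^ k represent all classes modulo p ^ k. *)
Lemma padic_int_approx x k : `| x |_p <= 1 ->
  exists2 n, (n < p ^ k)%N & `| x - n%:R |_p <= p%:R ^- k.
Proof.
rewrite -[x]reprK; set s : cauchySeq pr_p := repr x => x1.
have [N sN] := padic_norm_pi_le1 x1.
have e0 : 0 < p%:R ^- k :> rat by rewrite invr_gt0 exprn_gt0// ltr0n prime_gt0.
have [M sM] := cauchySeqP s e0.
set K := maxn N M.
have [n nk Kn] := rat_padic_approx pr_p k (sN K (leq_maxl _ _)).
exists n => //; rewrite -(rmorph_nat \pi_Qp) -rmorphB.
have -> : p%:R ^- k = ratr (p%:R ^- k) :> R.
  by rewrite fmorphV rmorphXn/= rmorph_nat.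
apply: padic_norm_pi_le; exists M => m Mm /=.
rewrite [X in nrm X](_ : _ = (s m - s K) + (s K - n%:R)).
  rewrite (le_trans (rat_padic_normD pr_p _ _))// ge_max Kn ltW// sM//.
  exact: leq_maxr.
by rewrite addrA subrK -(cauchySeq_natE n m).
Qed.

(** The sequence a, being a Cauchy sequence of rational numbers, represents an
    element of Q_p, and this element is its limit. *)
Lemma padic_int_complete (a : nat -> nat) :
  (forall k l, (k <= l)%N -> `| ((a k)%:R - (a l)%:R : Qp) |_p <= p%:R ^- k) ->
  exists x : Qp, forall k, `| x - (a k)%:R |_p <= p%:R ^- k.
Proof.
have pk k : p%:R ^- k = ratr (p%:R ^- k) :> R.
  by rewrite fmorphV rmorphXn/= rmorph_nat.
move=> aP; have {}aP k l : (k <= l)%N -> nrm ((a l)%:R - (a k)%:R) <= p%:R ^- k.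
  by move=> /aP; rewrite padic_distrC padic_norm_natB pk ler_rat.
have ca : padic_cauchy p (fun k => (a k)%:R).
  move=> e e0.
  have [k ke] : exists k, p%:R ^- k < e.
    by apply: exp_inv_small => //; rewrite ltr1n prime_gt1.
  exists k => m n km kn; apply: le_lt_trans ke.
  rewrite -[(a m)%:R](subrK (a k)%:R) -addrA.
  rewrite (le_trans (rat_padic_normD pr_p _ _))// ge_max aP//=.
  by rewrite -rat_padic_normN opprB aP.
have cs : (fun k => (a k)%:R) \in cauchy_seqs pr_p by exact/asboolP.
exists (\pi_Qp (CauchySeq cs)) => k.
rewrite -(rmorph_nat \pi_Qp) -rmorphB pk; apply: padic_norm_pi_le.
by exists k => n /aP; rewrite -(cauchySeq_natE (a k) n).
Qed.

End PadicIntegers.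

(** * The projective line: ultrametric and compact *)

Section ProjectiveLine.
Local Open Scope quotient_scope.
Variables (R : realType) (p : nat) (pr_p : prime p).
Local Notation Qp := (padic pr_p).
Local Notation P1 := (padic_proj_line R pr_p).
Local Notation "`| x |_p" := (padic_norm R x) (at level 0, x at level 99).
Implicit Types (x y : Qp) (a b c : hcoord Qp) (u v w : P1).

(** The class of a, in the type that carries the spherical metric. *)
Definition ppoint a : P1 := \pi_(proj_line Qp) a.

Lemma eq_proj_line (K : fieldType) (a b : hcoord K) :
  proj_equiv a b -> \pi_(proj_line K) a = \pi_(proj_line K) b.
Proof. by move=> ab; apply/(@eqquotP _ _ (proj_line K)). Qed.

Definition normalized a := Num.max `|a.1|_p `|a.2|_p = 1.

Lemma normalized_le1 a : normalized a -> `|a.1|_p <= 1 /\ `|a.2|_p <= 1.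
Proof. by move=> <-; rewrite !le_max !lexx orbT. Qed.

Lemma mdist_normalized a b : normalized a -> normalized b ->
  mdist (ppoint a) (ppoint b) = `|a.1 * b.2 - b.1 * a.2|_p.
Proof.
move=> na nb; rewrite [LHS](spherical_distE R a b) /hcoord_dist.
by rewrite na nb mulr1 divr1.
Qed.

Let pair1_neq0 x : (x, 1) != (0, 0) :> Qp * Qp.
Proof. by rewrite xpair_eqE oner_eq0 andbF. Qed.

Let pair_1neq0 x : (1, x) != (0, 0) :> Qp * Qp.
Proof. by rewrite xpair_eqE oner_eq0. Qed.

(** The two unit balls that cover the projective line, around 0 and around
    infinity. *)
Definition chart (at_infty : bool) x : hcoord Qp :=
  if at_infty then HCoord (pair_1neq0 x) else HCoord (pair1_neq0 x).

Lemma normalized_chart i x : `|x|_p <= 1 -> normalized (chart i x).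
Proof.
move=> x1; rewrite /normalized.
by case: i => /=; rewrite padic_norm1; [rewrite max_l|rewrite max_r].
Qed.

Lemma mdist_chart i x y : `|x|_p <= 1 -> `|y|_p <= 1 ->
  mdist (ppoint (chart i x)) (ppoint (chart i y)) = `|x - y|_p.
Proof.
move=> x1 y1; rewrite mdist_normalized; try exact: normalized_chart.
by case: i => /=; rewrite ?mul1r ?mulr1 // padic_distrC.
Qed.

Lemma chart_onto u : exists i x, `|x|_p <= 1 /\ u = ppoint (chart i x).
Proof.
rewrite -[u](@reprK _ (proj_line Qp)); set a := repr _.
have nV x : `|x^-1|_p = `|x|_p^-1.
  have [->|x0] := eqVneq x 0; first by rewrite invr0 padic_norm0 invr0.
  have nx0 : `|x|_p != 0 by rewrite padic_norm_eq0.
  by apply: (mulfI nx0); rewrite -padic_normM !divff// padic_norm1.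
have nz x y : `|x|_p <= `|y|_p -> y != 0 -> `|x / y|_p <= 1.
  move=> xy y0; rewrite padic_normM nV ler_pdivrMr ?padic_norm_neq0_gt0//.
  by rewrite mul1r.
have [a21|/ltW a12] := leP `|a.2|_p `|a.1|_p.
  have a1 : a.1 != 0.
    case/orP: (hcoordP a) => // a2; rewrite -(padic_norm_eq0 R) gt_eqF//.
    by rewrite (lt_le_trans _ a21)// padic_norm_neq0_gt0.
  exists true, (a.2 / a.1); split; first exact: nz.
  by apply: eq_proj_line; rewrite /proj_equiv/= mul1r mulrC divfK.
have a2 : a.2 != 0.
  case/orP: (hcoordP a) => // a1; rewrite -(padic_norm_eq0 R) gt_eqF//.
  by rewrite (lt_le_trans _ a12)// padic_norm_neq0_gt0.
exists false, (a.1 / a.2); split; first exact: nz.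
by apply: eq_proj_line; rewrite /proj_equiv/= mulr1 divfK.
Qed.

Lemma normalized_repr u : exists2 a, normalized a & u = ppoint a.
Proof.
have [i [x [x1 ->]]] := chart_onto u.
by exists (chart i x) => //; exact: normalized_chart.
Qed.

(** Multiplying a1 c2 - c1 a2 by a coordinate of b of norm 1 turns it into a
    combination of a1 b2 - b1 a2 and b1 c2 - c1 b2 with integral
    coefficients. *)
Lemma spherical_ultrametric v u w :
  mdist u w <= Num.max (mdist u v) (mdist v w).
Proof.
have [a na ->] := normalized_repr u; have [b nb ->] := normalized_repr v.
have [c nc ->] := normalized_repr w; rewrite !mdist_normalized//.
have [a1 a2] := normalized_le1 na; have [c1 c2] := normalized_le1 nc.
have h (x y z : Qp) : `|x|_p = 1 -> `|y|_p <= 1 -> `|z|_p <= 1 ->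
    x * (a.1 * c.2 - c.1 * a.2) =
      y * (a.1 * b.2 - b.1 * a.2) + z * (b.1 * c.2 - c.1 * b.2) ->
    `|a.1 * c.2 - c.1 * a.2|_p <=
      Num.max `|a.1 * b.2 - b.1 * a.2|_p `|b.1 * c.2 - c.1 * b.2|_p.
  move=> x1 y1 z1 e; rewrite -[leLHS]mul1r -x1 -padic_normM e.
  rewrite (le_trans (padic_normD _ _ _))// !padic_normM ge_max !le_max.
  by rewrite !ler_piMl ?padic_norm_ge0 ?orbT.
move: nb; rewrite /normalized maxEle; case: ifP => _ b1.
  by apply: (h b.2 c.2 a.2) => //; ring.
by apply: (h b.1 c.1 a.1) => //; ring.
Qed.

(** An ultrafilter lives in one of the two charts, and there, for every k, in
    one of the p ^ k classes modulo p ^ k; these classes are nested, hence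
    shrink to a point by completeness. *)
Lemma compact_proj_line : compact [set: P1].
Proof.
have p1 : 1 < p%:R :> R by rewrite ltr1n prime_gt1.
rewrite compact_ultra => F FU _.
(* The points of chart i with coordinate congruent to n modulo p ^ k. *)
pose D i n k : set P1 := [set u | exists x, [/\ `|x|_p <= 1,
  u = ppoint (chart i x) & `|x - n%:R|_p <= p%:R ^- k]].
have pigeonhole (I : finType) (A : I -> set P1) :
    (forall u, exists i, A i u) -> exists i, F (A i).
  move=> cov; apply: contrapT => /forallNP nA.
  have /filter_ex[u uA] : \forall u \near F, forall i, (~` A i) u.
    by apply: filter_forall => i; case: (in_ultra_setVsetC (A i) FU) => // /nA.
  by have [j] := cov u; exact: uA.
have [i Fi] : exists i, F (D i 0%N 0%N).
  apply: pigeonhole => u; have [i [x [x1 ->]]] := chart_onto u.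
  by exists i, x; split=> //; rewrite subr0 expr0 invr1.
have /choice[a Fa] : forall k, exists n, F (D i n k).
  (* Adding to each class the points outside the chart makes the classes cover
     the whole line. *)
  move=> k; have cov u : exists n : 'I_(p ^ k)%N,
      (~` D i 0%N 0%N `|` D i n k) u.
    have [[x [x1 ux _]]|nu] := pselect (D i 0%N 0%N u); last first.
      have pk : (0 < p ^ k)%N by rewrite expn_gt0 prime_gt0.
      by exists (Ordinal pk); left.
    have [n nk xn] := padic_int_approx k x1.
    by exists (Ordinal nk); right; exists x.
  have [n Fn] := pigeonhole _ _ cov.
  by exists n; apply: filterS2 Fi Fn => u Di [].
have aP k l : (k <= l)%N -> `|((a k)%:R - (a l)%:R : Qp)|_p <= p%:R ^- k.
  move=> kl; have [_ [[x [x1 -> xk]] [y [y1 xy yl]]]] :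
      (D i (a k) k `&` D i (a l) l) !=set0.
    by apply: (@filter_ex _ F); exact: filterI.
  have {}xy : x = y.
    apply/eqP; rewrite -subr_eq0 -(padic_norm_eq0 R) -(mdist_chart i)// xy.
    by rewrite mdistxx.
  apply: (@padic_dist_le _ _ _ _ x); rewrite padic_distrC// xy.
  rewrite (le_trans yl)// lef_pV2 ?posrE ?exprn_gt0 ?ler_eXn2l//;
  exact: lt_trans p1.
have [z zP] := padic_int_complete aP.
have z1 : `|z|_p <= 1.
  have z0 : `|z - (a 0%N)%:R|_p <= 1 by have := zP 0%N; rewrite expr0 invr1.
  rewrite -(subrK (a 0%N)%:R z).
  exact: padic_normD_le z0 (padic_norm_nat_le1 _ _ _).
exists (ppoint (chart i z)); split=> //; apply/cvg_ballP => e e0.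
have [k ke] := exp_inv_small p1 e0.
apply: filterS (Fa k) => _ [x [x1 -> xk]]; rewrite ballEmdist/= mdist_chart//.
by apply: le_lt_trans ke; apply: (@padic_dist_le _ _ _ _ (a k)%:R).
Qed.

End ProjectiveLine.

(** * Good reduction and distances *)

Section Reduction.
Variables (R : realType) (p : nat) (pr_p : prime p).
Local Notation Qp := (padic pr_p).
Local Notation "`| x |_p" := (padic_norm R x) (at level 0, x at level 99).
Local Notation red := (padic_red R).
Implicit Types (x y : Qp) (F G : {poly Qp}).

Lemma padic_norm_sum_le (I : Type) (s : seq I) (f : I -> Qp) (e : R) : 0 <= e ->
  (forall i, `|f i|_p <= e) -> `|\sum_(i <- s) f i|_p <= e.
Proof.
move=> e0 fe; elim/big_ind : _ => [|x y|i _]; last exact: fe.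
  by rewrite padic_norm0.
exact: padic_normD_le.
Qed.

Lemma padic_normM_le1 x y : `|x|_p <= 1 -> `|y|_p <= 1 -> `|x * y|_p <= 1.
Proof.
by move=> x1 y1; rewrite padic_normM -[1]mulr1 ler_pM ?padic_norm_ge0.
Qed.

Lemma padic_normX_le1 x n : `|x|_p <= 1 -> `|x ^+ n|_p <= 1.
Proof.
move=> x1; elim: n => [|n IH]; first by rewrite expr0 padic_norm1.
by rewrite exprS padic_normM_le1.
Qed.

Lemma padic_norm_natB_lt1 m n :
  (`|(m%:R - n%:R : Qp)|_p < 1) = (m == n %[mod p])%N.
Proof.
wlog mn : m n / (m <= n)%N => [th|].
  case/orP: (leq_total m n) => [/th//|/th].
  by rewrite padic_distrC eq_sym.
by rewrite padic_distrC -natrB// padic_norm_nat_lt1 eq_sym eqn_mod_dvd.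
Qed.

(** The residues less than 1 apart from x form a single class modulo p. *)
Lemma padic_redE x n : `|x - n%:R|_p < 1 -> red x = n%:R.
Proof.
move=> xn; rewrite /padic_red; case: xgetP => [k _ /= xk|/(_ n%:R)[]] /=.
  have kn : ((k : nat) = n %[mod p])%N.
    apply/eqP; rewrite -padic_norm_natB_lt1.
    have -> : k%:R - n%:R = (x - n%:R) - (x - k%:R) by ring.
    rewrite (le_lt_trans (padic_normD _ _ _))// padic_normN.
    by rewrite gt_max xn.
  have kp : (k < p)%N by rewrite -[X in (_ < X)%N](Fp_cast pr_p) ltn_ord.
  by apply: val_inj; rewrite /= val_Fp_nat// -kn modn_small.
rewrite val_Fp_nat//.
have -> : x - (n %% p)%:R = (x - n%:R) + (n%:R - (n %% p)%:R) by ring.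
rewrite (le_lt_trans (padic_normD _ _ _))// gt_max xn.
by rewrite padic_norm_natB_lt1 modn_mod/=.
Qed.

Lemma padic_int_residue x : `|x|_p <= 1 -> exists n, `|x - n%:R|_p < 1.
Proof.
move=> /(padic_int_approx 1)[n _ xn]; exists n; rewrite (le_lt_trans xn)//.
by rewrite expr1 invf_lt1 ?ltr0n ?ltr1n ?prime_gt1 ?prime_gt0.
Qed.

Lemma padic_red0 x : `|x|_p < 1 -> red x = 0.
Proof. by move=> x1; rewrite (@padic_redE _ 0%N) ?subr0. Qed.

Lemma padic_red1 : red (1 : Qp) = 1.
Proof. by rewrite (@padic_redE _ 1%N) ?subrr ?padic_norm0. Qed.

Lemma padic_redD x y : `|x|_p <= 1 -> `|y|_p <= 1 ->
  red (x + y) = red x + red y.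
Proof.
move=> /padic_int_residue[m xm] /padic_int_residue[n yn].
rewrite (padic_redE xm) (padic_redE yn) -natrD; apply: padic_redE.
have -> : x + y - (m + n)%:R = (x - m%:R) + (y - n%:R) by rewrite natrD; ring.
by rewrite (le_lt_trans (padic_normD _ _ _))// gt_max xm.
Qed.

Lemma padic_redM x y : `|x|_p <= 1 -> `|y|_p <= 1 ->
  red (x * y) = red x * red y.
Proof.
move=> x1; move: (x1) => /padic_int_residue[m xm] /padic_int_residue[n yn].
rewrite (padic_redE xm) (padic_redE yn) -natrM; apply: padic_redE.
have -> : x * y - (m * n)%:R = x * (y - n%:R) + (x - m%:R) * n%:R.
  by rewrite natrM; ring.
rewrite (le_lt_trans (padic_normD _ _ _))// !padic_normM gt_max.
rewrite (le_lt_trans _ yn) ?ler_piMl ?padic_norm_ge0//.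
by rewrite (le_lt_trans _ xm)// ler_piMr ?padic_norm_ge0 ?padic_norm_nat_le1.
Qed.

Lemma padic_redX x n : `|x|_p <= 1 -> red (x ^+ n) = red x ^+ n.
Proof.
move=> x1; elim: n => [|n IH]; first by rewrite !expr0 padic_red1.
rewrite 2!exprS padic_redM; [by rewrite IH|exact: x1|exact: padic_normX_le1].
Qed.

Lemma padic_red_sum (I : Type) (s : seq I) (f : I -> Qp) :
  (forall i, `|f i|_p <= 1) ->
  red (\sum_(i <- s) f i) = \sum_(i <- s) red (f i).
Proof.
move=> f1; elim: s => [|i s IH].
  by rewrite !big_nil padic_red0 ?padic_norm0.
by rewrite !big_cons padic_redD ?IH// padic_norm_sum_le.
Qed.

Definition integral_poly F := forall i, `|F`_i|_p <= 1.

Let monomial_le1 F (a : Qp * Qp) i m n : integral_poly F ->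
  `|a.1|_p <= 1 -> `|a.2|_p <= 1 -> `|F`_i * a.1 ^+ m * a.2 ^+ n|_p <= 1.
Proof.
move=> F1 a1 a2; apply: padic_normM_le1; last exact: padic_normX_le1.
by apply: padic_normM_le1; [exact: F1|exact: padic_normX_le1].
Qed.

(** Reduction modulo p respects sums and products of p-adic integers. *)
Lemma hom_eval_red d F (a : Qp * Qp) : integral_poly F ->
  `|a.1|_p <= 1 -> `|a.2|_p <= 1 ->
  Fp_bar_inj p (red (hom_eval d F a)) =
  hom_eval d (poly_red R F) (Fp_bar_inj p (red a.1), Fp_bar_inj p (red a.2)).
Proof.
move=> F1 a1 a2; rewrite padic_red_sum => [|i]; last exact: monomial_le1.
rewrite rmorph_sum; apply: eq_bigr => i _.
have red0 : Fp_bar_inj p (red (0 : Qp)) = 0.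
  by rewrite padic_red0 ?rmorph0// padic_norm0 ltr01.
have a1i := padic_normX_le1 i a1; have a2i := padic_normX_le1 (d - i) a2.
rewrite /poly_red coef_map_id0; last exact: red0.
rewrite (padic_redM (padic_normM_le1 (F1 i) a1i) a2i) (padic_redM (F1 i) a1i).
by rewrite (padic_redX i a1) (padic_redX (d - i) a2) !rmorphM !rmorphXn.
Qed.

Lemma hom_eval_le1 d F (a : Qp * Qp) : integral_poly F ->
  `|a.1|_p <= 1 -> `|a.2|_p <= 1 -> `|hom_eval d F a|_p <= 1.
Proof.
move=> F1 a1 a2; apply: padic_norm_sum_le => [|i]; first exact: ler01.
exact: monomial_le1.
Qed.

(** A point where both forms have norm less than 1 would reduce to a common
    zero of the reduced forms. *)
Lemma hom_eval_normalized d F G (a : hcoord Qp) :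
  integral_poly F -> integral_poly G -> normalized R a ->
  (forall u : proj_line (Fp_bar p),
     ~ (hom_eval d (poly_red R F) (repr u) = 0 /\
        hom_eval d (poly_red R G) (repr u) = 0)) ->
  Num.max `|hom_eval d F a|_p `|hom_eval d G a|_p = 1.
Proof.
move=> F1 G1 na noz; have [a1 a2] := normalized_le1 na.
have Fa1 := hom_eval_le1 d F1 a1 a2; have Ga1 := hom_eval_le1 d G1 a1 a2.
apply/le_anti/andP; split.
  by rewrite ge_max; apply/andP; split; [exact: Fa1|exact: Ga1].
rewrite leNgt; apply/negP; rewrite gt_max => /andP[Fa Ga].
pose b := (Fp_bar_inj p (red a.1), Fp_bar_inj p (red a.2)).
have b0 : b != (0, 0).
  have inj x : `|x|_p = 1 -> Fp_bar_inj p (red x) != 0.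
    move=> x1; rewrite fmorph_eq0; apply/eqP => x0.
    (* A natural number less than 1 apart from a unit is prime to p. *)
    have [n xn] : exists n, `|x - n%:R|_p < 1.
      by apply: padic_int_residue; rewrite x1.
    move/eqP: x0; rewrite (padic_redE xn) -(dvdn_pcharf (pchar_Fp pr_p)).
    rewrite -(padic_norm_nat_lt1 R pr_p) => n1; move: (ltxx (1 : R)).
    rewrite -{1}x1 -(subrK n%:R x) (le_lt_trans (padic_normD _ _ _))//.
    by rewrite gt_max xn.
  rewrite xpair_eqE negb_and; move: na; rewrite /normalized maxEle.
  by case: ifP => _ /inj nz; apply/orP; [right|left]; exact: nz.
have /proj_equivP[k k0 [e1 e2]] : proj_equiv (HCoord b0) (repr (proj_point b0)).
  by apply/(@eqquotP _ _ (proj_line (Fp_bar p))); rewrite reprK.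
have zero H : integral_poly H -> `|hom_eval d H a|_p < 1 ->
    hom_eval d (poly_red R H) (repr (proj_point b0)) = 0.
  move=> H1 Ha; rewrite (hom_evalZ d _ e1 e2) -(hom_eval_red d H1 a1 a2).
  by rewrite (padic_red0 Ha) rmorph0 mulr0.
exact: noz (proj_point b0) (conj (zero F F1 Fa) (zero G G1 Ga)).
Qed.

(** The monomials of degree d in a and b, with j <= i, have the common factor
    (a1 b1)^j (a2 b2)^(d - i); the rest is a difference of (i - j)-th powers
    of a1 b2 and b1 a2. *)
Lemma monomial_bracket_le d i j (a b : Qp * Qp) : (i <= d)%N -> (j <= d)%N ->
  `|a.1|_p <= 1 -> `|a.2|_p <= 1 -> `|b.1|_p <= 1 -> `|b.2|_p <= 1 ->
  `|a.1 ^+ i * a.2 ^+ (d - i) * (b.1 ^+ j * b.2 ^+ (d - j)) -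
    b.1 ^+ i * b.2 ^+ (d - i) * (a.1 ^+ j * a.2 ^+ (d - j))|_p
  <= `|a.1 * b.2 - b.1 * a.2|_p.
Proof.
move=> id jd a1 a2 b1 b2; wlog ji : i j id jd / (j <= i)%N => [th|].
  case/orP: (leq_total j i) => [/th|ij]; first exact.
  rewrite padic_distrC [X in X - _]mulrC [X in _ - X]mulrC.
  exact: th.
have -> : a.1 ^+ i * a.2 ^+ (d - i) * (b.1 ^+ j * b.2 ^+ (d - j)) -
    b.1 ^+ i * b.2 ^+ (d - i) * (a.1 ^+ j * a.2 ^+ (d - j)) =
  (a.1 * b.1) ^+ j * (a.2 * b.2) ^+ (d - i) *
    ((a.1 * b.2) ^+ (i - j) - (b.1 * a.2) ^+ (i - j)).
  have -> : (d - j = (d - i) + (i - j))%N by rewrite addnBA// subnK.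
  rewrite -[in a.1 ^+ i](subnK ji) -[in b.1 ^+ i](subnK ji) !exprMn !exprD.
  ring.
rewrite subrXX mulrCA padic_normM ler_piMr ?padic_norm_ge0//.
have ab1 : `|a.1 * b.1|_p <= 1 by exact: padic_normM_le1.
have ab2 : `|a.2 * b.2|_p <= 1 by exact: padic_normM_le1.
have a1b2 : `|a.1 * b.2|_p <= 1 by exact: padic_normM_le1.
have b1a2 : `|b.1 * a.2|_p <= 1 by exact: padic_normM_le1.
apply: padic_normM_le1.
  by apply: padic_normM_le1; exact: padic_normX_le1.
apply: padic_norm_sum_le => [|k]; first exact: ler01.
by apply: padic_normM_le1; exact: padic_normX_le1.
Qed.

(** The bracket is bilinear in F and G, so monomials suffice. *)
Lemma hom_eval_bracket_le d F G (a b : Qp * Qp) :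
  integral_poly F -> integral_poly G ->
  `|a.1|_p <= 1 -> `|a.2|_p <= 1 -> `|b.1|_p <= 1 -> `|b.2|_p <= 1 ->
  `|hom_eval d F a * hom_eval d G b - hom_eval d F b * hom_eval d G a|_p
  <= `|a.1 * b.2 - b.1 * a.2|_p.
Proof.
move=> F1 G1 a1 a2 b1 b2; rewrite /hom_eval !mulr_suml -sumrB.
apply: padic_norm_sum_le => [|i]; first exact: padic_norm_ge0.
rewrite !mulr_sumr -sumrB.
apply: padic_norm_sum_le => [|j]; first exact: padic_norm_ge0.
rewrite -!mulrA.
have -> : forall f g m1 m2 m3 m4 n1 n2 n3 n4 : Qp,
  f * (m1 * (m2 * (g * (m3 * m4)))) - f * (n1 * (n2 * (g * (n3 * n4)))) =
  f * g * (m1 * m2 * (m3 * m4) - n1 * n2 * (n3 * n4)) by move=> *; ring.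
have id : (i <= d)%N by rewrite -ltnS.
have jd : (j <= d)%N by rewrite -ltnS.
rewrite padic_normM (le_trans _ (monomial_bracket_le id jd a1 a2 b1 b2))//.
by apply: ler_piMl; [exact: padic_norm_ge0|exact: padic_normM_le1].
Qed.

End Reduction.

(** In lowest terms numerator and denominator are coprime, so a fraction of
    the same degree is proportional to the reduced one. *)
Lemma ratfun_fraction_scalar (K : fieldType) (r : {fraction {poly K}})
    (F G : {poly K}) :
  (size F <= (ratfun_deg r).+1)%N -> (size G <= (ratfun_deg r).+1)%N ->
  G != 0 -> r = FracField.tofrac F / FracField.tofrac G ->
  exists2 k : K, k != 0 & F = k *: ratfun_num r /\ G = k *: ratfun_den r.
Proof.
move=> sF sG G0 rE; set f := ratfun_num r; set g := ratfun_den r.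
have g0 : g != 0 := ratfun_den_neq0 r.
have FG : F * g = G * f.
  apply/eqP; rewrite -tofrac_eq !tofracM.
  have G0' : FracField.tofrac G != 0 by rewrite tofrac_eq0.
  have g0' : FracField.tofrac g != 0 by rewrite tofrac_eq0.
  rewrite [eqbRHS]mulrC -(eqr_div _ _ G0' g0') -rE.
  by apply/eqP; exact: ratfun_num_den.
have /dvdpP[h Gh] : g %| G.
  have : g %| G * f by rewrite -FG dvdp_mull.
  by rewrite Gauss_dvdpl// coprimep_sym ratfun_coprime.
have Fh : F = h * f.
  by apply: (mulIf g0); rewrite FG Gh mulrAC.
have h0 : h != 0 by apply: contraNneq G0 => h0; rewrite Gh h0 mul0r.
have dE : maxn (size f) (size g) = (ratfun_deg r).+1.
  by rewrite prednK // leq_max !size_poly_gt0 g0 orbT.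
have sh : (size h <= 1)%N.
  have hs (q : {poly K}) : size q = (ratfun_deg r).+1 ->
      (size (h * q)%R <= (ratfun_deg r).+1)%N -> (size h <= 1)%N.
    move=> sq; have q0 : q != 0 by rewrite -size_poly_gt0 sq.
    by rewrite size_mul// sq addnS/= -add1n leq_add2r.
  move: dE; rewrite /maxn; case: ifP => _ s; [apply: hs s _|apply: hs s _].
    by rewrite -Gh.
  by rewrite -Fh.
have hE := size1_polyC sh.
have k0 : h`_0 != 0 by rewrite -polyC_eq0 -hE.
by exists h`_0; rewrite // -!mul_polyC -hE.
Qed.

Lemma hom_evalS (K : fieldType) d (k : K) (f : {poly K}) (a : K * K) :
  hom_eval d (k *: f) a = k * hom_eval d f a.
Proof. by rewrite mulr_sumr; apply: eq_bigr => i _; rewrite coefZ !mulrA. Qed.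

(** F and G send normalized coordinates to normalized coordinates of the image,
    so both distances are norms of 2 by 2 determinants. *)
Lemma good_reduction_nonexpanding (R : realType) (p : nat) (pr_p : prime p)
    (r : {fraction {poly padic pr_p}}) : good_reduction R r ->
  forall u v : padic_proj_line R pr_p,
    mdist (padic_ratmap r u) (padic_ratmap r v) <= mdist u v.
Proof.
move=> [F [G [[sF sG G0 rE] FG1 _ noz]]] u v.
have F1 : integral_poly R F by move=> i; case: (FG1 i).
have G1 : integral_poly R G by move=> i; case: (FG1 i).
have [k k0 [Fk Gk]] := ratfun_fraction_scalar sF sG G0 rE.
set d := ratfun_deg r in noz.
have image (a : hcoord (padic pr_p)) : normalized R a ->
    exists2 b : hcoord (padic pr_p), normalized R b &
      [/\ padic_ratmap r (ppoint R a) = ppoint R b,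
          b.1 = hom_eval d F a & b.2 = hom_eval d G a].
  move=> na; have nFG := hom_eval_normalized F1 G1 na noz.
  have b0 : (hom_eval d F a, hom_eval d G a) != (0, 0).
    rewrite xpair_eqE; apply/negP => /andP[/eqP Fa /eqP Ga].
    move: nFG; rewrite Fa Ga padic_norm0 maxxx => /esym/eqP.
    by rewrite oner_eq0.
  exists (HCoord b0) => //; split => //.
  rewrite /padic_ratmap [LHS]ratmapE; apply: eq_proj_line; apply/proj_equivP.
  by exists k => //=; rewrite -!hom_evalS -Fk -Gk.
have [a na ->] := normalized_repr u; have [b nb ->] := normalized_repr v.
have [a' na' [-> a1 a2]] := image _ na; have [b' nb' [-> b1 b2]] := image _ nb.
rewrite !mdist_normalized// a1 a2 b1 b2.
have [? ?] := normalized_le1 na; have [? ?] := normalized_le1 nb.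
exact: hom_eval_bracket_le.
Qed.

Theorem corollary5 (R : realType) (p : nat) (pr_p : prime p)
    (c : nat -> R[i])
    (c_osc : oscillating c) (c_growth : growth_condition c)
    (r : {fraction {poly padic pr_p}}) (r_good : good_reduction R r) :
  linearly_disjoint (@padic_ratmap R p pr_p r) c.
Proof.
apply: nonexpanding_linearly_disjoint => //.
- exact: compact_proj_line.
- exact: spherical_ultrametric.
- exact: good_reduction_nonexpanding.
Qed.
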